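(* Let $n\ge1$, let $K$ be a field and $S=K[x_1,\dots,x_n]$. Let ${\bf A},{\bf B}\subset\mathbb{Z}_{\ge0}^n$ be non-empty finite subsets such that ${\bf 0}\notin{\bf A}$ and ${\bf B}\subseteq\{{\bf e}_1,\dots,{\bf e}_n\}$. Then the following conditions are equivalent. (a) The integer program $P_{{\bf A},{\bf B},k}$ has a solution for all $k\gg0$. (b) $I({\bf B})=(x_i:{\bf e}_i\in {\bf B})\in\mathrm{Ass}(I({\bf A})^k)$ for all $k\gg0$. (c) The Krull dimension of the module $H_{\mu(\mathfrak{p}S_{\mathfrak p})-1}(\mathfrak{p}S_{\mathfrak p};\mathcal{R}(\mathcal{I})_{\mathfrak p})$ is positive, where $\mathcal{I}=\{I({\bf A})^k\}_{k\ge0}$ and $\mathfrak{p}=I({\bf B})$. Furthermore, if any of the equivalent conditions hold, then for all $k\gg0$ the modulus of the optimal solution of $P_{{\bf A},{\bf B},k}$ is a linear function of the form $ak+b$, where $a,b\in\mathbb{Z}$ are suitable integers. In particular, $a\in\{|{\bf a}|:{\bf a}\in{\bf A}\}$.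
   Context: ${\bf e}_1,\dots,{\bf e}_n$ is the canonical basis of $\mathbb{Z}^n$, ${\bf 0}$ is the zero vector, and the modulus of ${\bf a}=(a_1,\dots,a_n)\in\mathbb{Z}^n$ is $|{\bf a}|=a_1+\cdots+a_n$. For a finite non-empty set ${\bf A}=\{{\bf a}_1,\dots,{\bf a}_m\}\subset\mathbb{Z}^n_{\ge0}$ and an integer $k\ge1$, set $$\mathcal{P}_k({\bf A})=\Big\{\sum_{i=1}^m k_i{\bf a}_i+\sum_{i=1}^n h_i{\bf e}_i\ :\ k_i,h_i\in\mathbb{Z}_{\ge0},\ \sum_{i=1}^m k_i\ge k\Big\}\subset\mathbb{Z}^n.$$ The integer program $P_{{\bf A},{\bf B},k}$ is: minimize (the modulus of) ${\bf c}\in\mathbb{Z}_{\ge0}^n$ subject to the condition that, for every ${\bf d}\in\mathbb{Z}_{\ge0}^n$, ${\bf c}+{\bf d}\in\mathcal{P}_k({\bf A})$ if and only if ${\bf d}\in\mathcal{P}_1({\bf B})$. A solution is a vector ${\bf c}$ satisfying this condition; an optimal solution is a solution whose modulus $|{\bf c}|$ is minimum among all solutions. For a non-empty subset ${\bf A}\subseteq\mathbb{Z}_{\ge0}^n$, $I({\bf A})\subset S$ is the monomial ideal generated by the monomials ${\bf x}^{\bf a}=x_1^{a_1}\cdots x_n^{a_n}$ with ${\bf a}\in{\bf A}$. For an ideal $I\subset S$, $\mathrm{Ass}(I)$ denotes the set of associated primes of $S/I$. For a filtration $\mathcal{I}=\{I_{[k]}\}_{k\ge0}$ of ideals of $S$,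 $\mathcal{R}(\mathcal{I})=\bigoplus_{k\ge0}I_{[k]}$ is its Rees algebra, and $\mathcal{R}(\mathcal{I})_{\mathfrak p}=\bigoplus_{k\ge0}(I_{[k]})_{\mathfrak p}$ is its localization at $\mathfrak p$. For an ideal $J$ of a Noetherian local ring $(A,\mathfrak{n})$, $\mu(J)=\dim_{A/\mathfrak n}(J/\mathfrak{n}J)$, and for an $A$-module $M$, $H_i(J;M)$ denotes the $i$th Koszul homology $H_i(f_1,\dots,f_m;M)$ of any minimal system of generators $f_1,\dots,f_m$ of $J$ (independent of the choice up to isomorphism). The Koszul homology in (c) is regarded as a graded $\mathcal{R}(\mathcal{I})_{\mathfrak p}$-module, and its Krull dimension is taken over this ring.
   Formalization: Condition (c) additionally requires I(A) ⊆ I(B) when B has exactly one element; without this the equivalence fails, e.g. for n=2, A={e_2}, B={e_1}, where (c) as printed holds but (a) and (b) fail. *)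

(* Defs.v *)
From mathcomp Require Import all_boot all_order all_algebra.
From mathcomp Require Import finmap mpoly.

Set Implicit Arguments.
Unset Strict Implicit.
Unset Printing Implicit Defensive.

Import GRing.Theory.
Local Open Scope ring_scope.

Definition eventually (Q : nat -> Prop) : Prop :=
  exists k0 : nat, forall k : nat, (k0 <= k)%N -> Q k.

(** * The integer program.
    Vectors with nonnegative integer entries are multinomials 'X_{1..n}:
    U_(i) is the i-th canonical basis vector, [mdeg] is the modulus. *)

Definition Pset (n : nat) (A : {fset 'X_{1..n}}) (k : nat) (v : 'X_{1..n}) :
    Prop :=
  exists (r : 'X_{1..n} -> nat) (h : 'I_n -> nat),
    (k <= \sum_(a <- A) r a)%N /\
    v = (\sum_(a <- A) (a *+ r a) + \sum_(i < n) (U_(i) *+ h i))%MM.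

Definition is_solution (n : nat) (A B : {fset 'X_{1..n}}) (k : nat)
    (c : 'X_{1..n}) : Prop :=
  forall d : 'X_{1..n}, Pset A k (c + d)%MM <-> Pset B 1 d.

Definition is_optimal_solution (n : nat) (A B : {fset 'X_{1..n}}) (k : nat)
    (c : 'X_{1..n}) : Prop :=
  is_solution A B k c /\
  forall c' : 'X_{1..n}, is_solution A B k c' -> (mdeg c <= mdeg c')%N.

(** * Commutative algebra inside an ambient ring.
    The rings S, S_p and the localized Rees algebra are handled as subsets [A]
    of an ambient commutative ring [R] (respectively S, Frac S, (Frac S)[T]);
    the following notions are relative to such a subring [A]. *)

Section Ideals.
Variable R : comNzRingType.
Implicit Types A I J P : R -> Prop.

Definition subset_of I J : Prop := forall x, I x -> J x.

Definition is_ideal A I : Prop :=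
  [/\ subset_of I A, I 0, forall x y, I x -> I y -> I (x + y)
    & forall a x, A a -> I x -> I (a * x)].

Definition is_prime A P : Prop :=
  [/\ is_ideal A P, ~ P 1
    & forall x y, A x -> A y -> P (x * y) -> P x \/ P y].

(* The ideal of A generated by G. *)
Definition ideal_gen A (G : R -> Prop) (x : R) : Prop :=
  exists s : seq (R * R),
    (forall u, u \in s -> A u.1 /\ G u.2) /\ x = \sum_(u <- s) u.1 * u.2.

Definition ideal_mul A I J : R -> Prop :=
  ideal_gen A (fun x => exists y z, [/\ I y, J z & x = y * z]).

Definition ideal_pow A I (k : nat) : R -> Prop :=
  ideal_gen A (fun x => exists2 s : seq R,
    size s = k /\ (forall y, y \in s -> I y) & x = \prod_(y <- s) y).

(* [is_mu A N J m]: mu(J) = m, that is, J/NJ has an (A/N)-basis with m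
   elements, given by the classes of the b_i; A is local with maximal ideal
   N. *)
Definition is_mu A N J (m : nat) : Prop :=
  exists b : 'I_m -> R,
    [/\ forall i, J (b i),
        forall x, J x -> exists2 a : 'I_m -> R, (forall i, A (a i))
          & ideal_mul A N J (x - \sum_(i < m) a i * b i)
      & forall a : 'I_m -> R, (forall i, A (a i)) ->
          ideal_mul A N J (\sum_(i < m) a i * b i) -> forall i, N (a i)].

Definition is_min_gens A J (m : nat) (f : 'I_m -> R) : Prop :=
  (forall x, J x <-> ideal_gen A (fun y => exists i, y = f i) x) /\
  forall i, ~ (forall x,
    J x <-> ideal_gen A (fun y => exists2 j, j != i & y = f j) x).

(* d0 < dim M, where M is the A-module Z/Bd, a subquotient of W on which A
   acts by [act]. The dimension is that of A/Ann(M), the supremum of the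
   lengths d of the chains Q 0 < ... < Q d of primes containing Ann(M). *)
Definition ann_subquo A (W : Type) (act : R -> W -> W) (Z Bd : W -> Prop)
    (r : R) : Prop :=
  A r /\ forall z, Z z -> Bd (act r z).

Definition krull_dim_gt A (W : Type) (act : R -> W -> W) (Z Bd : W -> Prop)
    (d0 : nat) : Prop :=
  exists (d : nat) (Q : nat -> R -> Prop),
    [/\ (d0 < d)%N,
        forall i, (i <= d)%N ->
          is_prime A (Q i) /\ subset_of (ann_subquo A act Z Bd) (Q i)
      & forall i, (i < d)%N ->
          subset_of (Q i) (Q i.+1) /\ ~ subset_of (Q i.+1) (Q i)].

End Ideals.

Section Ass.
Variable R : comNzRingType.
Implicit Types I P : R -> Prop.

Definition whole : R -> Prop := fun _ => True.

(* P is the annihilator of the class of some g in R/I. *)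
Definition Ass I P : Prop :=
  is_prime whole P /\ exists g : R, forall x, P x <-> I (x * g).

End Ass.

(** * Koszul complex.
    A chain c stands for \sum_J c(J) e_J in V (x) \Lambda(F^m), with
    e_J = e_{j_1} /\ ... /\ e_{j_i} for J = {j_1 < ... < j_i}. *)

Section Koszul.
Variables (F : comNzRingType) (V : lmodType F) (m : nat) (f : 'I_m -> F).
Notation chain := {ffun {set 'I_m} -> V}.

(* d e_T = \sum_(j in T) (-1)^#{l in T | l < j} f_j e_(T \ j); below, T is
   j |: J. *)
Definition koszul_diff (c : chain) : chain :=
  [ffun J : {set 'I_m} => \sum_(j < m | j \notin J)
     (((-1) ^+ #|[set l in J | (l < j)%N]| * f j) *: c (j |: J))].

(* Degree i chains with coefficients in the submodule M of V. *)
Definition koszul_chain (M : V -> Prop) (i : nat) (c : chain) : Prop :=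
  (forall J, M (c J)) /\ (forall J : {set 'I_m}, #|J| != i -> c J = 0).

Definition koszul_cycle (M : V -> Prop) (i : nat) (c : chain) : Prop :=
  koszul_chain M i c /\ koszul_diff c = 0.

Definition koszul_boundary (M : V -> Prop) (i : nat) (c : chain) : Prop :=
  exists2 c', koszul_chain M i.+1 c' & c = koszul_diff c'.

End Koszul.

Definition ffun_lmul (R : comNzRingType) (T : finType) (r : R)
    (c : {ffun T -> R}) : {ffun T -> R} := [ffun t => r * c t].

(** * Localization and Rees algebras over a domain S.
    S_p and the localization I_p of an ideal are taken inside Frac S. The Rees
    algebra of a filtration I, localized at p, is
    \sum_k (I_[k])_p T^k inside (Frac S)[T]. *)

Section Localization.
Variable S : idomainType.
Implicit Types (p I : S -> Prop).

Definition loc p I (x : {fraction S}) : Prop :=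
  exists a s, [/\ I a, ~ p s & x = tofrac a / tofrac s].

Definition loc_ring p : {fraction S} -> Prop := loc p (@whole S).

Definition rees_loc p (I : nat -> S -> Prop) (q : {poly {fraction S}}) :
    Prop :=
  forall k, loc p (I k) q`_k.

(* H_(mu - 1)(p S_p; R(I)_p) has Krull dimension > d0 over R(I)_p. If p has
   height one and does not contain I_[1], then mu = 1 and this is
   H_0 = k(p)[T], of dimension one, although p is in no Ass(I_[1]^k). *)
Definition koszul_dim_gt p (I : nat -> S -> Prop) (d0 : nat) : Prop :=
  exists (m : nat) (f : 'I_m -> {fraction S}),
    [/\ is_mu (loc_ring p) (loc p p) (loc p p) m,
        is_min_gens (loc_ring p) (loc p p) f
      & krull_dim_gt (rees_loc p I) (@ffun_lmul _ _)
          (koszul_cycle f (rees_loc p I) m.-1)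
          (koszul_boundary f (rees_loc p I) m.-1) d0].

End Localization.

Definition monomial_ideal (n : nat) (K : fieldType) (A : {fset 'X_{1..n}}) :
    {mpoly K[n]} -> Prop :=
  ideal_gen (@whole _) (fun x => exists2 a, a \in A & x = 'X_[K, a]).
Arguments monomial_ideal {n} K A x.

(* Main.v *)
(* A solution at step k is an exponent c with (I(A)^k : x^c) = I(B), and for a
   monomial ideal the associated prime I(B) of I(A)^k is always such a colon.

   Pulled back to the multiplicities of the generators and the variables, the solutions of
   all steps form a difference of two upward closed subsets of some N^s. By
   Dickson's lemma, membership is insensitive to raising a coordinate that is
   already large. At a large step k some a in A occurs many times in each
   solution c: then c - a solves step k - 1 and c + t a solves step k + t for all
   t. So solvability for infinitely many k and for all large k are the same, and
   the minimal moduli v satisfy v(k+1) - v(k) <= |a| <= v(k) - v(k-1): the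
   increments are eventually constant and equal to some |a|.

   For any generators f_1, ..., f_m of pS_p, a Koszul cycle of degree m - 1 over
   a submodule M of (Frac S)[T] has up to sign the form (f_j w)_j, so the homology
   is {w : pS_p w <= M} / M. For M = R(I)_p its degree k part is nonzero exactly
   when step k is solvable (for k >= 1 and, when |B| = 1, I(A) <= p). If
   it vanishes in all large degrees, every prime over the annihilator is the
   maximal homogeneous ideal. Otherwise the class of x^c T^k is not killed by the
   powers of x^a T, which gives a smaller prime over the annihilator. *)

Require Import Defs.
From mathcomp Require Import all_boot all_order all_algebra.
From mathcomp Require Import finmap mpoly.
From mathcomp Require boolp classical_sets.
From mathcomp Require Import zify ring.
Import GRing.Theory.
Local Open Scope ring_scope.

Set Implicit Arguments.
Unset Strict Implicit.
Unset Printing Implicit Defensive.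

(** * Solutions of the integer program *)

Section Dickson.
Local Open Scope nat_scope.
Variable I : eqType.

(** Induction on the coordinates. The finite set [G0] obtained for the other coordinates has [j]-th
    values below some [N], so a point with [j]-th value at least [N] lies above one of its members;
    the finitely many slices with smaller [j]-th value are handled one by one by the induction
    hypothesis. *)
Lemma dickson (s : seq I) (P : (I -> nat) -> Prop) :
  exists G : seq (I -> nat), (forall g, List.In g G -> P g) /\
    forall x, P x -> exists2 g, List.In g G & forall i, i \in s -> g i <= x i.
Proof.
elim: s P => [|j s IH] P.
  have [[x Px]|nP] := boolp.EM (exists x, P x).
    by exists [:: x]; split=> [g [<-|//]|y _] //; exists x => //; left.
  by exists [::]; split=> // x Px; case: nP; exists x.
have [G0 [G0P G0min]] := IH P.
have slices N : exists G : seq (I -> nat), (forall g, List.In g G -> P g) /\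
    forall x, P x -> x j < N ->
      exists2 g, List.In g G & forall i, i \in j :: s -> g i <= x i.
  elim: N => [|N [G [GP Gmin]]]; first by exists [::].
  have [H [HP Hmin]] := IH (fun x => P x /\ x j = N).
  exists (G ++ H); split=> [g /(@List.in_app_or _ _ _ _)[/GP|/HP[]]//|x Px].
  rewrite ltnS leq_eqVlt => /predU1P[xN|/(Gmin x Px)[g gG lgx]]; last first.
    by exists g => //; apply: List.in_or_app; left.
  have [g gH lgx] := Hmin x (conj Px xN).
  exists g => [|i]; first by apply: List.in_or_app; right.
  by rewrite inE => /predU1P[->|/lgx//]; rewrite (HP g gH).2 xN.
have [N ltN] : exists N, forall g, List.In g G0 -> g j < N.
  elim: (G0) => [|g G [N ltN]]; first by exists 0.
  exists (maxn (g j).+1 N) => h [<-|/ltN ltgN]; first exact: leq_maxl.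
  exact: leq_trans ltgN (leq_maxr _ _).
have [G [GP Gmin]] := slices N; exists (G0 ++ G).
split=> [g /(@List.in_app_or _ _ _ _)[/G0P|/GP]//|x Px].
have [/(Gmin x Px)[g gG lgx]|leNx] := ltnP (x j) N.
  by exists g => //; apply: List.in_or_app; right.
have [g gG0 lgx] := G0min x Px.
exists g => [|i]; first by apply: List.in_or_app; left.
rewrite inE => /predU1P[->|/lgx//].
exact: leq_trans (ltnW (ltN g gG0)) leNx.
Qed.

Definition incr (a : I) (x : I -> nat) : I -> nat := fun i => x i + (i == a).

(** Take for [N] a bound on the coordinates of the finitely many points generating [V]: once [x a]
    reaches [N], none of them distinguishes [x] from [incr a x]. *)
Lemma upset_incr (s : seq I) (V : (I -> nat) -> Prop) :
  (forall x y, V x -> (forall i, i \in s -> x i <= y i) -> V y) ->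
  exists N, forall x a, N <= x a -> (V (incr a x) <-> V x).
Proof.
move=> Vup; have [G [GV Gmin]] := dickson s V.
have [N leN] : exists N, forall g i, List.In g G -> i \in s -> g i <= N.
  elim: {GV Gmin} G => [|g G [N leN]]; first by exists 0.
  exists (maxn (\max_(i <- s) g i) N) => h i [<-|hG] si.
    by rewrite leq_max; apply/orP; left; exact: (@leq_bigmax_seq _ s xpredT g).
  by rewrite leq_max leN ?orbT.
exists N => x a leNx; split=> [Vx|]; last by move/Vup; apply=> i _; apply: leq_addr.
have [g gG lgx] := Gmin _ Vx; apply: (Vup g) => [|i si]; first exact: GV.
have := lgx i si; have := leN g i gG si; rewrite /incr.
by case: (eqVneq i a) => [->|_]; lia.
Qed.

End Dickson.

(** * Arithmetic of the sets P_k(A) *)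

Section PowerSets.
Local Open Scope nat_scope.
Variable n : nat.
Implicit Types (A B : {fset 'X_{1..n}}) (a b c d u v : 'X_{1..n}) (k : nat).

Definition pdeg A (r : 'X_{1..n} -> nat) := \sum_(a <- A) r a.
Definition pval A (r : 'X_{1..n} -> nat) := (\sum_(a <- A) (a *+ r a))%MM.

Lemma pdeg_incr A a r : a \in A -> pdeg A (incr a r) = (pdeg A r).+1.
Proof.
move=> aA; rewrite /pdeg (bigD1_seq a) ?fset_uniq //=.
rewrite [in RHS](bigD1_seq a) ?fset_uniq //= /incr eqxx addn1.
rewrite addSn; congr (_ + _).+1.
by apply: eq_bigr => b /negPf->; rewrite addn0.
Qed.

Lemma pval_incr A a r : a \in A -> pval A (incr a r) = (a + pval A r)%MM.
Proof.
move=> aA; rewrite /pval (bigD1_seq a) ?fset_uniq //=.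
rewrite [in RHS](bigD1_seq a) ?fset_uniq //= /incr eqxx addn1.
rewrite mulmS -addmA; congr (_ + (_ + _))%MM.
by apply: eq_bigr => b /negPf->; rewrite addn0.
Qed.

Lemma decrK a (r : 'X_{1..n} -> nat) : 0 < r a ->
  incr a (fun b => r b - (b == a)) =1 r.
Proof. by move=> ra b; rewrite /incr; case: eqVneq => [->|_]; lia. Qed.

Lemma PsetP A k v : Pset A k v <->
  exists r h, k <= pdeg A r /\ v = (pval A r + h)%MM.
Proof.
split=> [[r [h [ler ->]]]|[r [h [ler ->]]]]; exists r; first by eexists.
by exists h; rewrite {1}(multinomUE_id h).
Qed.

Lemma Pset0 A v : Pset A 0 v.
Proof. by apply/PsetP; exists (fun=> 0), v; rewrite /pval big1 ?add0m. Qed.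

(** Among at least k + 1 summands some generator has positive multiplicity and can be split off.
    This recursion drives the later inductions on [k]. *)
Lemma PsetS A k v :
  Pset A k.+1 v <-> exists a u, [/\ a \in A, v = (a + u)%MM & Pset A k u].
Proof.
split=> [/PsetP[r [h [ler ->]]]|[a [u [aA -> /PsetP[r [h [ler ->]]]]]]].
  have [a aA ra] : exists2 a, a \in A & 0 < r a.
    apply/hasP; apply: contraTT ler => /hasPn r0.
    by rewrite -leqNgt /pdeg big1_seq // => a /andP[_ /r0]; lia.
  have Er := decrK ra; set r' := (X in incr a X) in Er.
  exists a, (pval A r' + h)%MM; split=> //.
    rewrite addmA -pval_incr //; congr (_ + _)%MM.
    by apply: eq_bigr => b _; rewrite Er.
  apply/PsetP; exists r', h; split=> //; rewrite -ltnS -(pdeg_incr r' aA).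
  by rewrite /pdeg (eq_bigr _ (fun b _ => Er b)).
by apply/PsetP; exists (incr a r), h; rewrite pdeg_incr // pval_incr // addmA.
Qed.

Lemma PsetD A j k u v : Pset A j u -> Pset A k v -> Pset A (j + k) (u + v)%MM.
Proof.
move=> /PsetP[r [h [ler ->]]] /PsetP[r' [h' [ler' ->]]]; apply/PsetP.
exists (fun a => r a + r' a), (h + h')%MM; split.
  by rewrite /pdeg big_split leq_add.
have -> : pval A (fun a => r a + r' a) = (pval A r + pval A r')%MM.
  rewrite /pval -big_split; apply: eq_bigr => a _.
  by apply/mnmP => i; rewrite !(mnmE, mulmnE) mulnDr.
by apply/mnmP=> i; rewrite !mnmE; lia.
Qed.

Lemma Pset_le A j k v : j <= k -> Pset A k v -> Pset A j v.
Proof.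
move=> lejk /PsetP[r [h [ler ->]]]; apply/PsetP.
by exists r, h; split=> //; apply: leq_trans ler.
Qed.

Lemma Pset_addr A k u v : Pset A k u -> Pset A k (u + v)%MM.
Proof. by move=> Pu; rewrite -[k]addn0; apply: PsetD => //; apply: Pset0. Qed.

(** Generators in excess of [k] have nonnegative entries, so they can be absorbed into the free part
    [h]. *)
Lemma Pset_exact A k v : Pset A k v ->
  exists r h, pdeg A r = k /\ v = (pval A r + h)%MM.
Proof.
elim: k v => [|k IH] v.
  by exists (fun=> 0), v; rewrite /pval /pdeg !big1 ?add0m.
move=> /PsetS[a [u [aA -> /IH[r [h [<- ->]]]]]].
by exists (incr a r), h; rewrite pdeg_incr // pval_incr // addmA.
Qed.

Lemma Pset_mulm A v t : Pset A 1 v -> Pset A t (v *+ t)%MM.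
Proof.
move=> Pv; elim: t => [|t IH]; first exact: Pset0.
by rewrite mulmS -[t.+1]add1n; apply: PsetD.
Qed.

Lemma Pset1 A v : Pset A 1 v <-> exists2 a, a \in A & (a <= v)%MM.
Proof.
split=> [/PsetS[a [u [aA -> _]]]|[a aA av]]; first by exists a; rewrite ?lem_addr.
by apply/PsetS; exists a, (v - a)%MM; rewrite addmC submK //; split=> //; apply: Pset0.
Qed.

End PowerSets.

(** * Passing between solutions at consecutive large steps *)

Section Stabilization.
Local Open Scope nat_scope.
Variables (n : nat) (A B : {fset 'X_{1..n}}) (b : 'X_{1..n}).
Hypothesis bB : b \in B.
Implicit Types (x y : 'X_{1..n} + 'I_n -> nat) (a c d : 'X_{1..n}).

(** A point [x] is a way of writing a vector: left coordinates are multiplicities of generators,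
    right ones of basis vectors. Dickson's lemma is applied to these expressions, on the finite list
    [coords], and not to the vectors themselves. *)
Let deg x := pdeg A (x \o inl).
Let val x := (pval A (x \o inl) + [multinom x (inr i) | i < n])%MM.

Let coords : seq ('X_{1..n} + 'I_n) := map inl A ++ map inr (enum 'I_n).

Let deg_incr x a : a \in A -> deg (incr (inl a) x) = (deg x).+1.
Proof. exact: (@pdeg_incr _ A a (x \o inl)). Qed.

Let val_incr x a : a \in A -> val (incr (inl a) x) = (a + val x)%MM.
Proof.
move=> aA; rewrite addmA -(pval_incr _ aA); congr (_ + _)%MM.
by apply/mnmP => i; rewrite !mnmE /incr addn0.
Qed.

Let val_le x y : (forall i, i \in coords -> x i <= y i) ->
  exists z, deg y = deg x + deg z /\ val y = (val x + val z)%MM.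
Proof.
move=> lexy; pose z i := y i - x i; exists z.
have leA a : a \in A -> x (inl a) <= y (inl a).
  by move=> aA; apply: lexy; rewrite mem_cat map_f.
split; first by rewrite /deg /pdeg -big_split; apply: eq_big_seq => a /leA /= /subnKC ->.
rewrite /val; have -> : pval A (y \o inl) =
    (pval A (x \o inl) + pval A (z \o inl))%MM.
  rewrite /pval -big_split; apply: eq_big_seq => a /leA /= lea.
  by apply/mnmP => i; rewrite !(mnmE, mulmnE) -mulnDr subnKC.
apply/mnmP => i; rewrite !mnmE.
suff : x (inr i) <= y (inr i) by rewrite /z; lia.
by apply: lexy; rewrite mem_cat orbC map_f // mem_enum.
Qed.

Let Pset_val x : Pset A (deg x) (val x).
Proof. by apply/PsetP; exists (x \o inl), [multinom x (inr i) | i < n]. Qed.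

(* Membership of [c + d] in [Pset A k] is monotone in [x], so solutions form a
   difference of two upward closed sets, to which Dickson's lemma applies. *)
Lemma solution_step : exists k0, forall k c, k0 <= k -> is_solution A B k.+1 c ->
  exists2 a, a \in A & (exists2 c', c = (a + c')%MM & is_solution A B k c') /\
    forall t, is_solution A B (k.+1 + t) (a *+ t + c)%MM.
Proof.
(* A solution [c] has [c + b] in P_k(A), so it is recovered as [val x] minus [b] from some
   expression [x]. [V] is one implication of the solution property and [W] the failure of the other,
   so solutions correspond to [V] minus [W]. *)
pose V x := exists2 c, val x = (c + b)%MM &
  forall d, Pset B 1 d -> Pset A (deg x) (c + d)%MM.
pose W x := exists2 c, val x = (c + b)%MM &
  exists2 d, ~ Pset B 1 d & Pset A (deg x) (c + d)%MM.
have upV x y : V x -> (forall i, i \in coords -> x i <= y i) -> V y.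
  move=> [c xE cP] /val_le[z [dE vE]]; exists (c + val z)%MM => [|d /cP cdP].
    by rewrite vE xE; apply/mnmP => i; rewrite !mnmE; lia.
  by rewrite dE -addmA [(val z + d)%MM]addmC addmA; apply: PsetD (Pset_val z).
have upW x y : W x -> (forall i, i \in coords -> x i <= y i) -> W y.
  move=> [c xE [d Nd cdP]] /val_le[z [dE vE]]; exists (c + val z)%MM.
    by rewrite vE xE; apply/mnmP => i; rewrite !mnmE; lia.
  exists d => //.
  by rewrite dE -addmA [(val z + d)%MM]addmC addmA; apply: PsetD (Pset_val z).
have [N1 incrV] := upset_incr upV; have [N2 incrW] := upset_incr upW.
pose N := maxn N1 N2.
have solE x c : val x = (c + b)%MM -> (is_solution A B (deg x) c <-> V x /\ ~ W x).
  move=> xE; split=> [sol|[[c1 c1E Vc] NW] d].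
    split; first by exists c => // d /sol.
    by move=> [c1]; rewrite xE => /addIm<- [d Nd /sol].
  move: c1E; rewrite xE => /addIm Ec; rewrite -{c1}Ec in Vc; split=> [cdP|/Vc//].
  by apply: boolp.contrapT => Nd; case: NW; exists c => //; exists d.
have incr_sol x a : N <= x (inl a) -> (V (incr (inl a) x) /\ ~ W (incr (inl a) x)
    <-> V x /\ ~ W x).
  rewrite geq_max => /andP[le1 le2].
  by move: (incrV x _ le1) (incrW x _ le2); tauto.
(* Pigeonhole: if every generator occurred at most [N] times, at most this many would be used, fewer
   than k + 1. *)
exists (\sum_(a <- A) N) => k c lek sol.
have /Pset_exact[r [h [rE cbE]]] : Pset A k.+1 (c + b)%MM.
  by apply/sol/Pset1; exists b => //; apply: lepm_refl.
have [a aA ltNr] : exists2 a, a \in A & N < r a.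
  apply/hasP; apply: contraTT lek => /hasPn leN; rewrite -ltnNge -ltnS -rE ltnS.
  by rewrite /pdeg !big_seq; apply: leq_sum => a /leN; rewrite -leqNgt.
(* One copy of [a] is removed, so that [incr (inl a) x] is the expression of [c + b]. *)
pose x i := match i with inl a' => r a' - (a' == a) | inr i => h i end.
have xE : pdeg A (incr a (x \o inl)) = k.+1 /\
    (pval A (incr a (x \o inl)) + h)%MM = (c + b)%MM.
  by rewrite (boolp.funext (decrK (leq_trans _ ltNr))).
have hE : [multinom x (inr i) | i < n] = h by apply/mnmP => i; rewrite mnmE.
move: xE; rewrite pdeg_incr // pval_incr // => -[[degx] valx].
have {}valx : (a + val x = c + b)%MM by rewrite /val hE addmA.
have leNx : N <= x (inl a) by rewrite /= eqxx; lia.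
(* Even after the removal [a] occurs at least [N] times, so membership in [V] minus [W] passes from
   the expression of [c + b] down to [x], and then to all further increments. *)
have Ex : V x /\ ~ W x.
  apply/(incr_sol _ _ leNx)/(solE _ c); rewrite ?deg_incr // ?val_incr //.
  by rewrite /deg degx.
exists a => //; split.
  have [[c' c'E _] _] := Ex; exists c'.
    by apply: (@addIm _ b); rewrite -valx c'E addmA.
  by rewrite -degx; apply/solE.
(* Step k + 1 + t takes t + 1 increments of [x], since [x] lacks the copy of [a] that was
   removed. *)
move=> t; pose y s := iter s (incr (inl a)) x.
have leNy s : N <= y s (inl a).
  by elim: s => // s IH; apply: leq_trans IH (leq_addr _ _).
have degy s : deg (y s) = k + s.
  by elim: s => [|s IH]; rewrite ?addn0 // [y _]/= deg_incr // -/(y s) IH addnS.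
have valy s : (a + val (y s) = a *+ s + c + b)%MM.
  elim: s => [|s IH]; first by rewrite valx add0m.
  by rewrite [y _]/= val_incr // -/(y s) IH mulmS !addmA.
rewrite addSnnS -degy; apply/solE; first by rewrite val_incr // -/(y t) valy.
elim: t.+1 => // s IH; exact/incr_sol.
Qed.

End Stabilization.

(** * Eventual solvability and linearity of the optimal modulus *)

Section Linearity.
Local Open Scope nat_scope.

Lemma exists_minimal (T : Type) (f : T -> nat) (P : T -> Prop) :
  (exists x, P x) -> exists2 x, P x & forall y, P y -> f x <= f y.
Proof.
move=> [x Px]; have [m] := ubnP (f x); elim: m x Px => // m IH x Px lefx.
have [[y [Py ltyx]]|nP] := boolp.EM (exists y, P y /\ f y < f x).
  by apply: (IH y Py); apply: leq_trans ltyx lefx.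
exists x => // y Py; rewrite leqNgt; apply/negP => ltyx; apply: nP.
by exists y.
Qed.

(* The increments of [v] are nonincreasing and consecutive ones enclose a value
   satisfying [P], so they stabilize at such a value. *)
Lemma eventually_affine (v : nat -> nat) (P : nat -> Prop) k0 :
    (forall k, k0 <= k ->
      exists2 d, P d & v k + d <= v k.+1 /\ v k.+2 <= v k.+1 + d) ->
  exists2 d, P d & exists k1, forall k, k1 <= k -> v k = v k1 + d * (k - k1).
Proof.
move=> step; pose dv k := v k.+1 - v k.
have v_le k : k0 <= k -> v k <= v k.+1 by case/step=> d _; lia.
have dv_le k : k0 <= k -> dv k.+1 <= dv k by case/step=> d _; rewrite /dv; lia.
(* A nonincreasing sequence of naturals is constant from any point where it attains its minimum. *)
have [k1 lek1 min1] : exists2 k1, k0 <= k1 & forall k, k0 <= k -> dv k1 <= dv k.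
  by apply: exists_minimal; exists k0.
have dvE k : k1 <= k -> dv k = dv k1.
  elim: k => [|k IH] lek; first by move: lek; rewrite leqn0 => /eqP<-.
  move: lek; rewrite leq_eqVlt => /predU1P[<-//|lek].
  have le0k := leq_trans lek1 lek.
  by apply/anti_leq; rewrite min1 ?(leqW le0k) // -IH // dv_le.
(* The two inequalities say that [d] lies between [dv k1.+1] and [dv k1], which are equal. *)
have [d Pd led] := step k1 lek1; have Ed : d = dv k1.
  by move: (dvE k1.+1 (leqnSn _)) (v_le k1 lek1) (v_le k1.+1 (leqW lek1)); rewrite /dv; lia.
exists d => //; exists k1 => k lek; rewrite -(subnKC lek) addKn.
elim: (k - k1) => [|j IH]; first by rewrite addn0 muln0 addn0.
have := dvE (k1 + j) (leq_addr _ _); rewrite -Ed.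
have := v_le (k1 + j) (leq_trans lek1 (leq_addr _ _)).
by rewrite /dv addnS mulnS; lia.
Qed.

Variables (n : nat) (A B : {fset 'X_{1..n}}).

Lemma exists_optimal k :
  (exists c, is_solution A B k c) -> exists c, is_optimal_solution A B k c.
Proof. by move=> /(exists_minimal (@mdeg n))[c solc minc]; exists c. Qed.

Hypothesis nzB : B != fset0.

(** At large steps a solution yields one at the preceding step, so a single unsolvable large step
    makes all later ones unsolvable. *)
Lemma solvable_or_not :
  eventually (fun k => exists c, is_solution A B k c) \/
  eventually (fun k => ~ exists c, is_solution A B k c).
Proof.
have /fset0Pn[b bB] := nzB; have [k0 step] := solution_step A bB.
have [|N] := boolp.EM (exists2 k1, k0 <= k1 & ~ exists c, is_solution A B k1 c).
  move=> [k1 lek1 Nsol]; right; exists k1 => k lek; rewrite -(subnKC lek).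
  elim: (k - k1) => [|j IH]; first by rewrite addn0.
  rewrite addnS => -[c /step[|a _ [[c' _ solc'] _]]]; last by apply: IH; exists c'.
  exact: leq_trans (leq_addr _ _).
left; exists k0 => k lek; apply: boolp.contrapT => Nsol; apply: N.
by exists k.
Qed.

(** Removing [a] from an optimal solution at step k + 1 gives a solution at step k, and adding [a]
    gives one at step k + 2. Comparison with the minima there encloses [mdeg a] between consecutive
    increments. *)
Lemma optimal_modulus_linear :
  eventually (fun k => exists c, is_solution A B k c) ->
  exists a b : int, (exists2 v, v \in A & a = (mdeg v)%:Z) /\
    eventually (fun k => (exists c, is_optimal_solution A B k c) /\
      forall c, is_optimal_solution A B k c -> ((mdeg c)%:Z = a * k%:Z + b)%R).
Proof.
move=> [k1 sol]; have /fset0Pn[b bB] := nzB.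
have [k0 step] := solution_step A bB.
(* The guard makes [opt k] satisfiable for small [k] too, so that choice yields a sequence defined
   everywhere. *)
pose opt k c := k1 <= k -> is_optimal_solution A B k c.
have /boolp.choice[c optc] k : exists c, opt k c.
  have [/sol/exists_optimal[c opt_c]|ltk] := leqP k1 k; first by exists c.
  by exists 0%MM => lek; move: ltk; rewrite ltnNge lek.
pose v k := mdeg (c k).
have [|d [a aA ->] [k2 vE]] := @eventually_affine v
  (fun d => exists2 a, a \in A & d = mdeg a) (maxn k0 k1).
  move=> k; rewrite geq_max => /andP[le0 le1].
  have [solk mink] := optc k.+1 (leqW le1).
  have [a aA [[c' cE solc'] /(_ 1) sola]] := step k (c k.+1) le0 solk.
  exists (mdeg a); first by exists a.
  have [_ /(_ _ solc')] := optc k le1.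
  have [_ /(_ (a + c k.+1)%MM)] := optc k.+2 (leqW (leqW le1)).
  move: sola; rewrite mulm1n addn1 => sola /(_ sola).
  have vk : v k.+1 = mdeg a + mdeg c' by rewrite /v cE mdegD.
  by rewrite mdegD -/(v _) -/(v _) -/(v _); lia.
exists (mdeg a)%:Z, ((v k2)%:Z - (mdeg a * k2)%:Z)%R; split; first by exists a.
exists (maxn k1 k2) => k; rewrite geq_max => /andP[le1 le2].
have [solk mink] := optc k le1; split; first by exists (c k).
move=> c' [/mink le' /(_ _ solk) le'']; have := vE k le2.
rewrite /v in le' le'' * => E; have {}E : mdeg c' = mdeg (c k2) + mdeg a * (k - k2) by lia.
by rewrite E mulnBr; have := leq_mul (leqnn (mdeg a)) le2; lia.
Qed.

End Linearity.
(** * Koszul homology in degree m - 1 *)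

Section TopKoszulHomology.
Variables (F : fieldType) (V : lmodType F) (m : nat) (f : 'I_m -> F).
Implicit Types (c : {ffun {set 'I_m} -> V}) (w : V) (i j : 'I_m).

(** The sign of the basis element omitting [j] in the differential of e_1 /\ ... /\ e_m. *)
Definition koszul_sign j : F := (-1) ^+ #|[set l in ~: [set j] | (l < j)%N]|.

Definition koszul_top w : {ffun {set 'I_m} -> V} :=
  [ffun J => if J == setT then w else 0].

Lemma setU1C1 (T : finType) (x : T) : x |: ~: [set x] = setT.
Proof. by apply/setP => y; rewrite !inE orbN. Qed.

Lemma koszul_diff_topE w j :
  koszul_diff f (koszul_top w) (~: [set j]) = (koszul_sign j * f j) *: w.
Proof.
rewrite ffunE (big_pred1 j) => [|l]; last by rewrite !inE negbK.
by rewrite ffunE setU1C1 eqxx.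
Qed.

Lemma koszul_diff_top_out w (J : {set 'I_m}) :
  #|J| != m.-1 -> koszul_diff f (koszul_top w) J = 0.
Proof.
move=> cJ; rewrite ffunE big1 // => j jJ; rewrite ffunE; case: eqP => [JT|_].
  have mE : m = #|J|.+1 by rewrite -[LHS]card_ord -cardsT -JT cardsU1 jJ.
  by case/negP: cJ; apply/eqP; lia.
by rewrite scaler0.
Qed.

(** The sign attached to [i] is that of the top differential, while the one attached to [j] misses
    the index [i < j]; hence the minus. For a cycle these are the 2 by 2 relations making its
    coefficients proportional to the signed f_j. *)
Lemma koszul_diff_pairE c i j : (i < j)%N ->
  koszul_diff f c (~: [set i; j]) =
  (koszul_sign i * f i) *: c (~: [set j]) - (koszul_sign j * f j) *: c (~: [set i]).
Proof.
move=> ltij; have nij : i != j by apply: contraTneq ltij => ->; rewrite ltnn.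
rewrite ffunE (bigD1 i) /=; last by rewrite !inE eqxx.
rewrite (big_pred1 j) => [|l]; last first.
  rewrite !inE negbK; case: (eqVneq l i) => [->|] //=; first by rewrite (negPf nij).
  by rewrite andbT.
have -> : i |: ~: [set i; j] = ~: [set j].
  by apply/setP => l; rewrite !inE negb_or; case: eqVneq => [->|].
have -> : j |: ~: [set i; j] = ~: [set i].
  apply/setP => l; rewrite !inE negb_or; case: (eqVneq l j) => [->|] /=.
    by rewrite eq_sym nij.
  by rewrite andbT.
rewrite -scaleNr -mulNr; congr (_ *: _ + _ *: _).
  congr ((-1) ^+ #|pred_of_set _| * _); apply/setP => l; rewrite !inE negb_or.
  by rewrite -!val_eqE /=; lia.
congr (_ * _); rewrite /koszul_sign.
rewrite (cardsD1 i [set l in ~: [set j] | _]) !inE nij ltij add1n exprS mulN1r opprK.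
congr ((-1) ^+ #|pred_of_set _|); apply/setP => l; rewrite !inE negb_or.
by rewrite andbA.
Qed.

Variable M : V -> Prop.
Hypotheses (M0 : M 0) (MN : forall w, M w -> M (- w)).

Let Msign j w : M w -> M (koszul_sign j *: w).
Proof.
move=> Mw; rewrite /koszul_sign; elim: #|_| => [|k]; first by rewrite scale1r.
by rewrite exprS mulN1r scaleNr => /MN.
Qed.

(** A chain of degree m lives on the full set only; positivity of [m] makes [m.-1.+1] equal to
    [m]. *)
Lemma koszul_top_boundaryP c : (0 < m)%N ->
  koszul_boundary f M m.-1 c <-> exists2 w, M w & c = koszul_diff f (koszul_top w).
Proof.
move=> m_gt0; rewrite /koszul_boundary prednK //; split=> [[c' [Mc' c'0] ->]|[w Mw ->]].
  exists (c' setT) => //; congr (koszul_diff f _); apply/ffunP => J; rewrite ffunE.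
  case: eqP => [->//|nJ]; rewrite c'0 //; apply: contra_notN nJ => cJ.
  by apply/eqP; rewrite eqEcard subsetT cardsT card_ord (eqP cJ) leqnn.
exists (koszul_top w) => //; split=> [J|J cJ]; rewrite ffunE; case: eqP => // JT.
by move: cJ; rewrite JT cardsT card_ord eqxx.
Qed.

(** Here [w] may lie outside [M]; only the products with the f_j have to lie in it. The two terms of
    the pair formula cancel by commutativity, so the differential squares to zero on the top
    chain. *)
Lemma koszul_top_cycle w : (forall j, M (f j *: w)) ->
  koszul_cycle f M m.-1 (koszul_diff f (koszul_top w)).
Proof.
move=> Mfw; split; last first.
  apply/ffunP => J; rewrite [RHS]ffunE.
  have [c2|nc2] := eqVneq #|~: J| 2%N; last first.
    rewrite ffunE big1 // => j jJ; rewrite koszul_diff_top_out ?scaler0 //.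
    apply: contra nc2 => /eqP c1; have := cardsC J; rewrite cardsU1 jJ card_ord in c1 *.
    by move: (ltn_ord j); lia.
  have /cards2P[i [j [nij JE]]] : #|~: J| == 2%N by apply/eqP.
  rewrite -[J]setCK {}JE; wlog ltij : i j nij / (i < j)%N => [WL|].
    have [ltij|ltji|/val_inj Eij] := ltngtP i j; first exact: WL.
      by rewrite setUC WL // eq_sym.
    by rewrite Eij eqxx in nij.
  by rewrite koszul_diff_pairE // !koszul_diff_topE !scalerA mulrC subrr.
split=> J => [|/koszul_diff_top_out->//].
have [cJ|/koszul_diff_top_out->//] := eqVneq #|J| m.-1.
(* For m = 0 the degree [m.-1] is 0 and the differential is an empty sum. *)
have [m0|m_gt0] := posnP m.
  by rewrite ffunE big1 // => j; move: (ltn_ord j); lia.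
have /cards1P[j JE] : #|~: J| == 1%N.
  by have := cardsC J; rewrite card_ord; lia.
by rewrite -[J]setCK JE koszul_diff_topE -scalerA; apply: Msign.
Qed.

(** Over the field [F] one may divide by f_j0: the pair relations then show that every coefficient
    is the signed f_j times the same [w]. *)
Lemma koszul_top_cycleP c j0 : f j0 != 0 -> koszul_cycle f M m.-1 c ->
  exists2 w, (forall j, M (f j *: w)) & c = koszul_diff f (koszul_top w).
Proof.
move=> nzf [[Mc c0] dc0]; pose g j := koszul_sign j * f j.
have signK j w : koszul_sign j *: (koszul_sign j *: w) = w.
  by rewrite scalerA -expr2 sqrr_sign scale1r.
have nzg : g j0 != 0 by rewrite mulf_neq0 // signr_eq0.
pose w := (g j0)^-1 *: c (~: [set j0]).
have cE j : c (~: [set j]) = g j *: w.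
  have gc : g j0 *: c (~: [set j]) = g j *: c (~: [set j0]).
    have [ltj|ltj|/val_inj->//] := ltngtP j j0; apply/eqP.
      by rewrite eq_sym -subr_eq0 -koszul_diff_pairE // dc0 ffunE.
    by rewrite -subr_eq0 -koszul_diff_pairE // dc0 ffunE.
  by rewrite /w scalerA mulrC -scalerA -gc scalerA mulVf // scale1r.
exists w => [j|].
  by rewrite -[X in M X](signK j) [koszul_sign j *: (f j *: w)]scalerA -/(g j) -cE; apply: Msign.
apply/ffunP => J.
have [cJ|ncJ] := eqVneq #|J| m.-1; last by rewrite koszul_diff_top_out ?c0.
have /cards1P[j JE] : #|~: J| == 1%N.
  by have := cardsC J; rewrite card_ord; move: (ltn_ord j0); lia.
by rewrite -[J]setCK JE cE koszul_diff_topE.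
Qed.

Lemma koszul_top_inj w w' j0 : f j0 != 0 ->
  koszul_diff f (koszul_top w) = koszul_diff f (koszul_top w') -> w = w'.
Proof.
move=> nzf /ffunP/(_ (~: [set j0])); rewrite !koszul_diff_topE => /scalerI; apply.
by rewrite mulf_neq0 // signr_eq0.
Qed.

End TopKoszulHomology.
(** * Monomial ideals *)

Section IdealGeneration.
Variables (R : comNzRingType) (A : R -> Prop).
Implicit Types (G : R -> Prop) (x y a : R).

Lemma ideal_gen0 G : ideal_gen A G 0.
Proof. by exists [::]; rewrite big_nil. Qed.

Lemma ideal_genD G x y : ideal_gen A G x -> ideal_gen A G y -> ideal_gen A G (x + y).
Proof.
move=> [s [sP ->]] [t [tP ->]]; exists (s ++ t); rewrite big_cat; split=> // u.
by rewrite mem_cat => /orP[/sP|/tP].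
Qed.

Lemma ideal_gen_mem G a x : A a -> G x -> ideal_gen A G (a * x).
Proof. by move=> Aa Gx; exists [:: (a, x)]; rewrite big_seq1; split=> // u /[!inE]/eqP->. Qed.

Lemma ideal_gen_ind G (P : R -> Prop) : P 0 ->
  (forall x y, P x -> P y -> P (x + y)) ->
  (forall a x, A a -> G x -> P (a * x)) -> subset_of (ideal_gen A G) P.
Proof.
move=> P0 PD Pmem _ [s [sP ->]]; rewrite big_seq.
by elim/big_ind: _ => // u /sP[]; apply: Pmem.
Qed.

Lemma ideal_genM G a x : (forall x y, A x -> A y -> A (x * y)) ->
  A a -> ideal_gen A G x -> ideal_gen A G (a * x).
Proof.
move=> AM Aa; elim/ideal_gen_ind: x / => [|x y|b x Ab Gx].
- by rewrite mulr0; apply: ideal_gen0.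
- by rewrite mulrDr; apply: ideal_genD.
by rewrite mulrA; apply: ideal_gen_mem => //; apply: AM.
Qed.

Lemma ideal_gen_sum G (I : Type) (r : seq I) (Q : pred I) (F : I -> R) :
  (forall i, Q i -> ideal_gen A G (F i)) -> ideal_gen A G (\sum_(i <- r | Q i) F i).
Proof. by move=> FG; apply: big_ind FG; [apply: ideal_gen0 | apply: ideal_genD]. Qed.

End IdealGeneration.

(** * Membership in monomial ideals and their powers, read off exponents *)

Section MonomialIdeals.
Variables (n : nat) (K : fieldType).
Implicit Types (A B : {fset 'X_{1..n}}) (f g : {mpoly K[n]}) (Q : 'X_{1..n} -> Prop).

Definition supported Q f := forall m, m \in msupp f -> Q m.

Lemma supported0 Q : supported Q 0.
Proof. by move=> m; rewrite msupp0. Qed.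

Lemma supportedD Q f g : supported Q f -> supported Q g -> supported Q (f + g).
Proof. by move=> Qf Qg m /msuppD_le; rewrite mem_cat => /orP[/Qf|/Qg]. Qed.

Lemma supportedM Q1 Q2 Q f g : (forall m1 m2, Q1 m1 -> Q2 m2 -> Q (m1 + m2)%MM) ->
  supported Q1 f -> supported Q2 g -> supported Q (f * g).
Proof. by move=> QD Qf Qg m /msuppM_le/allpairsP[[m1 m2] [/Qf Q1m /Qg Q2m ->]]; apply: QD. Qed.

Lemma supportedMl Q f g : (forall m1 m2, Q m2 -> Q (m1 + m2)%MM) ->
  supported Q g -> supported Q (f * g).
Proof. by move=> QD; apply: (@supportedM (fun=> True)) => // m1 m2 _; apply: QD. Qed.

Lemma supportedX Q m : supported Q 'X_[m] <-> Q m.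
Proof.
by split=> [|Qm m' /mem_msuppXP<-//]; apply; rewrite msuppX inE.
Qed.

Lemma Pset_addl A k u v : Pset A k v -> Pset A k (u + v)%MM.
Proof. by rewrite addmC; apply: Pset_addr. Qed.

Lemma monomial_idealP A f : monomial_ideal K A f <-> supported (Pset A 1) f.
Proof.
split; [elim/ideal_gen_ind: f / => [|x y|a _ _ [v vA ->]]|].
- exact: supported0.
- exact: supportedD.
- apply: supportedMl => [m1 m2|]; first exact: Pset_addl.
  by apply/supportedX/Pset1; exists v; rewrite ?lepm_refl.
move=> supf; rewrite /monomial_ideal (mpolyE f) big_seq; apply: ideal_gen_sum.
move=> m /supf/PsetS[a [u [aA -> _]]]; rewrite addmC mpolyXD scalerAl.
by apply: ideal_gen_mem => //; exists a.
Qed.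

Lemma ideal_powS (R : comNzRingType) (A I : R -> Prop) k x y :
  I y -> ideal_pow A I k x -> ideal_pow A I k.+1 (y * x).
Proof.
move=> Iy; elim/ideal_gen_ind: x / => [|x x'|a _ Aa [s [sk sI] ->]].
- by rewrite mulr0; apply: ideal_gen0.
- by rewrite mulrDr; apply: ideal_genD.
have -> : y * (a * \prod_(z <- s) z) = a * \prod_(z <- y :: s) z.
  by rewrite big_cons mulrCA.
apply: ideal_gen_mem => //.
by exists (y :: s) => //=; split=> [|z /predU1P[->|/sI]]; rewrite ?sk.
Qed.

(** Exponents in a product of [k] elements add up to P_k(A) by [PsetD]; conversely [PsetS] factors a
    monomial with exponent in P_k(A) one generator at a time. *)
Lemma powersP A k f :
  ideal_pow (@whole _) (monomial_ideal K A) k f <-> supported (Pset A k) f.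
Proof.
split; [elim/ideal_gen_ind: f / => [|x y|a _ _ [s [<- sI] ->]]|].
- exact: supported0.
- exact: supportedD.
- apply: supportedMl => [m1 m2|]; first exact: Pset_addl.
  elim: s sI => [|y s IH] sI; first by move=> m _; apply: Pset0.
  rewrite big_cons; apply: (@supportedM (Pset A 1) (Pset A (size s))).
  - by move=> m1 m2; rewrite [size _]/= -add1n; apply: PsetD.
  - by apply/monomial_idealP/sI; rewrite inE eqxx.
  by apply: IH => z zs; apply: sI; rewrite inE zs orbT.
move=> supf; rewrite (mpolyE f) big_seq; apply: ideal_gen_sum => m /supf Pm.
rewrite -mul_mpolyC; apply: ideal_genM => //; elim: k m Pm {supf} => [|k IH] m.
  move=> _; rewrite -['X_[m]]mulr1; apply: ideal_gen_mem => //.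
  by exists [::]; rewrite ?big_nil.
move=> /PsetS[a [u [aA -> Pu]]]; rewrite mpolyXD; apply: ideal_powS; last exact: IH.
by apply/monomial_idealP/supportedX/Pset1; exists a; rewrite ?lepm_refl.
Qed.

Section VariableIdeals.
Variable B : {fset 'X_{1..n}}.
Hypothesis Bvar : forall b, b \in B -> exists i : 'I_n, b = U_(i)%MM.

Lemma Pset1_var m : Pset B 1 m <-> exists2 i : 'I_n, U_(i)%MM \in B & m i != 0%N.
Proof.
split=> [/Pset1[b bB]|[i iB mi]]; last first.
  by apply/Pset1; exists U_(i)%MM; rewrite ?lep1mP.
by have [i Eb] := Bvar bB; rewrite Eb in bB *; rewrite lep1mP; exists i.
Qed.

(** A model of the quotient map modulo I(B) with values in S itself, so that the quotient being a
    domain comes for free. *)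
Definition kill_vars : {mpoly K[n]} -> {mpoly K[n]} :=
  mmap (@mpolyC n K) (fun i => if U_(i)%MM \in B then 0 else 'X_i).

Lemma kill_varsX m :
  (Pset B 1 m -> kill_vars 'X_[m] = 0) /\ (~ Pset B 1 m -> kill_vars 'X_[m] = 'X_[m]).
Proof.
rewrite /kill_vars mmapX /mmap1; split=> [/Pset1_var[i iB mi]|Nm].
  by rewrite (bigD1 i) //= iB expr0n (negPf mi) mul0r.
rewrite [RHS]mpolyXE_id; apply: eq_bigr => i _; case: ifP => // iB.
suff -> : m i = 0%N by rewrite !expr0.
by apply: boolp.contrapT => mi; apply/Nm/Pset1_var; exists i => //; apply/eqP.
Qed.

(** The map deletes the terms with exponent in P_1(B) and fixes the others, so no cancellation can
    occur. *)
Lemma kill_varsP f : kill_vars f = 0 <-> supported (Pset B 1) f.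
Proof.
have killE : kill_vars f = \sum_(m <- msupp f) f@_m *: kill_vars 'X_[m].
  rewrite {1}[f]mpolyE /kill_vars raddf_sum; apply: eq_bigr => m _.
  by rewrite /= mmapZ mul_mpolyC.
split=> [kf m mf|supf]; last first.
  rewrite killE big1_seq // => m /andP[_ /supf Pm].
  by rewrite (kill_varsX m).1 // scaler0.
apply: boolp.contrapT => Nm; have /negP[] : f@_m != 0 by rewrite -mcoeff_msupp.
have := congr1 (mcoeff m) kf; rewrite killE mcoeff0 raddf_sum /= => <-.
rewrite (bigD1_seq m) //= mcoeffZ (kill_varsX m).2 // mcoeffX eqxx mulr1 big1 ?addr0 //.
move=> m' nm; rewrite mcoeffZ; have [Pm'|Nm'] := boolp.EM (Pset B 1 m').
  by rewrite (kill_varsX m').1 // mcoeff0 mulr0.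
by rewrite (kill_varsX m').2 // mcoeffX (negPf nm) mulr0.
Qed.

Lemma monomial_ideal_is_ideal A : is_ideal (@whole _) (monomial_ideal K A).
Proof.
split=> // [|x y|a x _]; [exact: ideal_gen0|exact: ideal_genD|exact: ideal_genM].
Qed.

(** I(B) is the kernel of a ring morphism into a domain. *)
Lemma var_ideal_prime : is_prime (@whole _) (monomial_ideal K B).
Proof.
split=> [||f g _ _]; first exact: monomial_ideal_is_ideal.
  move=> /monomial_idealP/(_ 0%MM); rewrite msupp1 inE eqxx => /(_ isT)/Pset1_var[i _].
  by rewrite mnm0E.
rewrite !monomial_idealP -!kill_varsP /kill_vars rmorphM => /eqP.
by rewrite mulf_eq0 => /orP[]/eqP; [left|right].
Qed.

End VariableIdeals.
End MonomialIdeals.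
(** * Localized Rees algebras *)

Section PrimeAvoiding.
Variables (R : comNzRingType) (A J Sigma : R -> Prop).
Hypotheses (A1 : A 1) (AD : forall x y, A x -> A y -> A (x + y)).
Hypotheses (AM : forall x y, A x -> A y -> A (x * y)).
Hypotheses (idealJ : is_ideal A J) (Sigma1 : Sigma 1).
Hypotheses (SigmaM : forall x y, Sigma x -> Sigma y -> Sigma (x * y)).
Hypothesis (disjJ : forall x, J x -> ~ Sigma x).

(** Krull's argument: an ideal [Q] maximal among those containing [J] and disjoint from [Sigma] is
    prime. If [x] and [y] are outside [Q], then Q + Ax and Q + Ay meet [Sigma], and the product of
    two such elements would lie in [Q] as soon as x y does. *)
Lemma exists_prime_avoiding :
  exists Q, [/\ is_prime A Q, subset_of J Q & forall x, Q x -> ~ Sigma x].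
Proof.
pose avoiding Q := is_ideal A Q /\ forall x, Q x -> ~ Sigma x.
(* Adding [J] makes the union of the empty chain acceptable. *)
pose addJ (X : R -> Prop) x := X x \/ J x.
have [F FP totF|X [[idealX disjX] maxX]] :=
    @classical_sets.Zorn_bigcup R (fun X => avoiding (addJ X)).
  have [JA J0 JD JM] := idealJ.
  have common x y : addJ (classical_sets.bigcup F id) x ->
      addJ (classical_sets.bigcup F id) y ->
      (J x /\ J y) \/ exists X, [/\ F X, addJ X x & addJ X y].
    move=> [[X FX Xx]|Jx] [[Y FY Yy]|Jy]; last by left.
    - right; have [sXY|sYX] := totF X Y FX FY.
        by exists Y; split=> //; left=> //; apply: sXY.
      by exists X; split=> //; left=> //; apply: sYX.
    - by right; exists X; split=> //; [left|right].
    by right; exists Y; split=> //; [right|left].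
  have inU X x : F X -> addJ X x -> addJ (classical_sets.bigcup F id) x.
    by move=> FX [Xx|]; [left; exists X|right].
  split; [split|].
  - by move=> x [[X FX Xx]|/JA//]; have [[XA _ _ _] _] := FP X FX; apply: XA; left.
  - by right.
  - move=> x y Ux Uy; have [[Jx Jy]|[X [FX Xx Xy]]] := common x y Ux Uy.
      by right; apply: JD.
    by have [[_ _ XD _] _] := FP X FX; apply: (inU X) => //; apply: XD.
  - move=> a x Aa Ux; have [[Jx _]|[X [FX Xx _]]] := common x x Ux Ux.
      by right; apply: JM.
    by have [[_ _ _ XM] _] := FP X FX; apply: (inU X) => //; apply: XM.
  move=> x [[X FX Xx]|/disjJ//]; have [_ Xdisj] := FP X FX.
  by apply: Xdisj; left.
pose Q := addJ X; have [QA Q0 QD QM] := idealX.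
have A0 : A 0 by apply: QA.
have JQ : subset_of J Q by move=> x; right.
have maxQ Q' x : avoiding Q' -> subset_of Q Q' -> Q' x -> Q x.
  move=> avQ' QQ' Q'x; left; apply: boolp.contrapT => NXx.
  apply: (maxX Q'); last first.
    suff -> : addJ Q' = Q' by [].
    apply: boolp.funext => y; apply: boolp.propext; split=> [[]//|]; last by left.
    by move=> Jy; apply/QQ'/JQ.
  by split=> [y Xy|/(_ x Q'x)//]; apply: QQ'; left.
have meets x : A x -> ~ Q x -> exists q a, [/\ Q q, A a & Sigma (q + a * x)].
  move=> Ax NQx; apply: boolp.contrapT => Nmeet; apply: NQx.
  apply: (maxQ (fun z => exists q a, [/\ Q q, A a & z = q + a * x])).
  - split=> [|z [q [a [Qq Aa ->]]] Sz]; last by apply: Nmeet; exists q, a.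
    split=> [z [q [a [Qq Aa ->]]]||z z' [q [a [Qq Aa ->]]] [q' [a' [Qq' Aa' ->]]]|
             b z Ab [q [a [Qq Aa ->]]]].
    + by apply: AD; [apply: QA|apply: AM].
    + by exists 0, 0; rewrite mul0r addr0.
    + by exists (q + q'), (a + a'); rewrite mulrDl addrACA; split; [apply: QD|apply: AD|].
    by exists (b * q), (b * a); rewrite mulrDr mulrA; split; [apply: QM|apply: AM|].
  - by move=> q Qq; exists q, 0; rewrite mul0r addr0.
  by exists 0, 1; rewrite mul1r add0r; split.
exists Q; split=> //; split=> // [/disjX//|x y Ax Ay Qxy].
apply: boolp.contrapT => NQ.
have [q [a [Qq Aa Sx]]] := meets x Ax (fun Qx => NQ (or_introl Qx)).
have [q' [a' [Qq' Aa' Sy]]] := meets y Ay (fun Qy => NQ (or_intror Qy)).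
apply: (disjX _ _ (SigmaM Sx Sy)).
have -> : (q + a * x) * (q' + a' * y) =
    (q' + a' * y) * q + ((a * x) * q' + (a * a') * (x * y)) by ring.
apply/QD; first by apply/QM => //; apply/AD; [exact: QA|exact: AM].
by apply/QD; apply/QM => //; exact: AM.
Qed.

End PrimeAvoiding.

(** * Localization at a prime and the dimension of the Koszul homology *)

Section LocalRees.
Variables (S : idomainType) (P : S -> Prop).
Hypothesis primeP : is_prime (@whole S) P.
Implicit Types (I : S -> Prop) (a b s t : S) (x y : {fraction S}).

Let P0 : P 0. Proof. by have [[]] := primeP. Qed.
Let NP1 : ~ P 1. Proof. by have [] := primeP. Qed.
Let NPM s t : ~ P s -> ~ P t -> ~ P (s * t).
Proof. by have [_ _ PM] := primeP => NPs NPt /PM[]. Qed.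
Let nz s : ~ P s -> tofrac s != 0.
Proof. by move=> NPs; rewrite tofrac_eq0; apply: contra_notN NPs => /eqP->. Qed.

(** Cross-multiplication with another representative supplies the multiplier [t], so membership can
    be tested on any given fraction. *)
Lemma loc_fracP I a s : is_ideal (@whole S) I -> ~ P s ->
  (loc P I (tofrac a / tofrac s) <-> exists2 t, ~ P t & I (t * a)).
Proof.
move=> [_ _ _ IM] NPs; split=> [[b [t [Ib NPt /eqP]]]|[t NPt Ita]].
  rewrite eqr_div ?nz // -!tofracM tofrac_eq => /eqP E.
  by exists t => //; rewrite mulrC E mulrC; apply: IM.
exists (t * a), (t * s); split=> //; first exact: NPM.
by rewrite !tofracM -mulf_div divff ?nz // mul1r.
Qed.

Lemma loc_tofrac I a : I a -> loc P I (tofrac a).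
Proof. by move=> Ia; exists a, 1; rewrite tofrac1 divr1. Qed.

Lemma locD I x y : is_ideal (@whole S) I -> loc P I x -> loc P I y -> loc P I (x + y).
Proof.
move=> [_ _ ID IM] [a [s [Ia NPs ->]]] [b [t [Ib NPt ->]]].
exists (a * t + b * s), (s * t); split; last by rewrite tofracD !tofracM addf_div ?nz.
  by apply: ID; rewrite mulrC; apply: IM.
exact: NPM.
Qed.

Lemma locM I J L x y : (forall a b, I a -> J b -> L (a * b)) ->
  loc P I x -> loc P J y -> loc P L (x * y).
Proof.
move=> IJL [a [s [Ia NPs ->]]] [b [t [Jb NPt ->]]].
by exists (a * b), (s * t); rewrite mulf_div !tofracM; split; [apply: IJL|apply: NPM|].
Qed.

Lemma locZ I x y : is_ideal (@whole S) I -> loc_ring P x -> loc P I y -> loc P I (x * y).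
Proof. by move=> [_ _ _ IM]; apply: locM => a b _; apply: IM. Qed.

Lemma loc0 I : is_ideal (@whole S) I -> loc P I 0.
Proof. by move=> [_ I0 _ _]; rewrite -tofrac0; apply: loc_tofrac. Qed.

Lemma loc_sub I x : loc P I x -> loc_ring P x.
Proof. by move=> [a [s [_ NPs ->]]]; exists a, s. Qed.

Lemma loc_ring1 : loc_ring P 1.
Proof. by rewrite -tofrac1; apply: loc_tofrac. Qed.

Lemma whole_ideal : is_ideal (@whole S) (@whole S). Proof. by split. Qed.

Lemma loc_ringN1 : loc_ring P (-1).
Proof. by rewrite -tofrac1 -tofracN; apply: loc_tofrac. Qed.

Let idealP : is_ideal (@whole S) P. Proof. by have [] := primeP. Qed.

Lemma locP_frac a s : ~ P s -> loc P P (tofrac a / tofrac s) -> P a.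
Proof.
move=> NPs /(loc_fracP _ idealP NPs)[t NPt].
by have [_ _ PM] := primeP => /(PM _ _)[].
Qed.

Lemma loc_ringV x : loc_ring P x -> ~ loc P P x -> x != 0 /\ loc_ring P x^-1.
Proof.
move=> [a [s [_ NPs ->]]] NPx; have NPa : ~ P a by move=> Pa; apply: NPx; exists a, s.
by rewrite invf_div mulf_neq0 ?invr_eq0 ?nz //; split=> //; exists s, a.
Qed.

Lemma locP_prime x y : loc_ring P x -> loc_ring P y -> loc P P (x * y) ->
  loc P P x \/ loc P P y.
Proof.
move=> [a [s [_ NPs ->]]] [b [t [_ NPt ->]]]; rewrite mulf_div -!tofracM.
move=> /locP_frac-/(_ (NPM NPs NPt)); have [_ _ PM] := primeP => /(PM _ _)[] // H.
  by left; exists a, s.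
by right; exists b, t.
Qed.

Lemma locP1 : ~ loc P P 1.
Proof. by rewrite -(divr1 1) -tofrac1 => /locP_frac-/(_ NP1). Qed.

Variable I : nat -> S -> Prop.
Hypotheses (idealI : forall k, is_ideal (@whole S) (I k)) (I01 : I 0%N 1).
Hypothesis (IM : forall j k a b, I j a -> I k b -> I (j + k)%N (a * b)).

Local Notation Rees := (rees_loc P I).

Let locI0 x : loc P (I 0) x <-> loc_ring P x.
Proof.
split=> [/loc_sub//|Rx]; rewrite -[x]mulr1.
by apply: locZ => //; rewrite -tofrac1; apply: loc_tofrac.
Qed.

Lemma ReesD q r : Rees q -> Rees r -> Rees (q + r).
Proof. by move=> Rq Rr k; rewrite coefD; apply: locD. Qed.

Lemma loc_sum (L : S -> Prop) (T : Type) (e : seq T) (F : T -> {fraction S}) :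
  is_ideal (@whole S) L -> (forall i, loc P L (F i)) -> loc P L (\sum_(i <- e) F i).
Proof. by move=> idL LF; elim/big_ind: _ => *; [apply: loc0|apply: locD|]. Qed.

Lemma ReesM q r : Rees q -> Rees r -> Rees (q * r).
Proof.
move=> Rq Rr k; rewrite coefM; apply: loc_sum => // i.
apply: (locM _ (Rq i) (Rr (k - i)%N)) => a b Ia Ib.
by have := IM Ia Ib; rewrite subnKC // -ltnS.
Qed.

Lemma ReesCXn k x : loc P (I k) x -> Rees (x *: 'X^k).
Proof.
move=> Ix j; rewrite coefZ coefXn; case: eqP => [->|_]; first by rewrite mulr1.
by rewrite mulr0; apply: loc0.
Qed.

Lemma ReesC x : loc_ring P x -> Rees x%:P.
Proof. by move=> Rx; rewrite -alg_polyC -(expr0 'X); apply/ReesCXn/locI0. Qed.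

Lemma Rees1 : Rees 1.
Proof. exact/ReesC/loc_ring1. Qed.

Lemma ReesX (e : nat) q : Rees q -> Rees (q ^+ e).
Proof.
by move=> Rq; elim: e => [|e IH]; [apply: Rees1|rewrite exprS; apply: ReesM].
Qed.

Lemma ReesZ x q : loc_ring P x -> Rees q -> Rees (x *: q).
Proof. by move=> Rx Rq; rewrite -mul_polyC; apply: ReesM => //; apply: ReesC. Qed.

Lemma Rees0 : Rees 0.
Proof. by move=> k; rewrite coef0; apply: loc0. Qed.

Lemma ReesN q : Rees q -> Rees (- q).
Proof. by move=> Rq; rewrite -scaleN1r; apply: ReesZ => //; apply: loc_ringN1. Qed.

Definition Rees_colon (w : {poly {fraction S}}) :=
  forall x, loc P P x -> Rees (x *: w).

Variables (m : nat) (f : 'I_m -> {fraction S}).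
Hypotheses (fP : forall j, loc P P (f j)).
Hypothesis genf : forall x, loc P P x ->
  ideal_gen (loc_ring P) (fun y => exists j, y = f j) x.
Variable j0 : 'I_m.
Hypothesis nzf : f j0 != 0.

Lemma Rees_colonP w : (forall j, Rees (f j *: w)) -> Rees_colon w.
Proof.
move=> Rfw x /genf; elim/ideal_gen_ind: x / => [|x y|a _ Ra [j ->]].
- by rewrite scale0r; apply: Rees0.
- by rewrite scalerDl; apply: ReesD.
by rewrite -scalerA; apply: ReesZ.
Qed.

Lemma ffun_lmul_koszul_top (r w : {poly {fraction S}}) :
  ffun_lmul r (koszul_diff f (koszul_top m w)) = koszul_diff f (koszul_top m (r * w)).
Proof.
apply/ffunP => J; rewrite !ffunE mulr_sumr; apply: eq_bigr => j _.
by rewrite !ffunE -scalerAr; case: ifP => //; rewrite !mulr0.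
Qed.

(* The homology in degree [m - 1] is [(Rees : P) / Rees]. *)
Lemma ann_koszulP (r : {poly {fraction S}}) : let Z := koszul_cycle f Rees m.-1 in
  let Bd := koszul_boundary f Rees m.-1 in
  ann_subquo Rees (@ffun_lmul _ _) Z Bd r <->
  Rees r /\ forall w, Rees_colon w -> Rees (r * w).
Proof.
have m_gt0 : (0 < m)%N by apply: leq_ltn_trans (ltn_ord j0).
split=> [[Rr annr]|[Rr annr]]; split=> // w.
  move=> colw.
  have Zw : koszul_cycle f Rees m.-1 (koszul_diff f (koszul_top m w)).
    by apply: koszul_top_cycle => [|v|j]; [exact: Rees0|exact: ReesN|exact/colw].
  have /(koszul_top_boundaryP _ Rees0 _ m_gt0)[w' Rw'] := annr _ Zw.
  by rewrite ffun_lmul_koszul_top => /(koszul_top_inj nzf)->.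
move=> /(koszul_top_cycleP ReesN nzf)[w' /Rees_colonP/annr Rrw ->].
apply/(koszul_top_boundaryP _ Rees0 _ m_gt0).
by exists (r * w') => //; rewrite ffun_lmul_koszul_top.
Qed.

Let koszul_ann : {poly {fraction S}} -> Prop :=
  ann_subquo Rees (@ffun_lmul _ _) (koszul_cycle f Rees m.-1)
    (koszul_boundary f Rees m.-1).

(** The maximal homogeneous ideal, the kernel of the constant coefficient followed by reduction to
    the residue field. *)
Let Rees_max (q : {poly {fraction S}}) := Rees q /\ loc P P q`_0.

Lemma Rees_coef0 q : Rees q -> loc_ring P q`_0.
Proof. by move=> Rq; apply/locI0. Qed.

Lemma ann_koszul_ideal : is_ideal Rees koszul_ann.
Proof.
split=> [q []//||q r|a q Ra].
- by apply/ann_koszulP; split=> [|w _]; rewrite ?mul0r; apply: Rees0.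
- move=> /ann_koszulP[Rq annq] /ann_koszulP[Rr annr]; apply/ann_koszulP.
  by split=> [|w colw]; rewrite ?mulrDl; apply: ReesD => //; [apply: annq|apply: annr].
move=> /ann_koszulP[Rq annq]; apply/ann_koszulP; split=> [|w colw]; first exact: ReesM.
by rewrite -mulrA; apply: ReesM => //; apply: annq.
Qed.

Lemma Rees_max_prime : is_prime Rees Rees_max.
Proof.
split=> [||q r Rq Rr [_]]; last first.
- by rewrite coef0M => /(locP_prime (Rees_coef0 Rq) (Rees_coef0 Rr))[]; [left|right].
- by rewrite /Rees_max coef1 => -[_ /locP1].
split=> [q []//||q r [Rq Pq] [Rr Pr]|a q Ra [Rq Pq]].
- by split; [apply: Rees0|rewrite coef0; apply: loc0].
- by split; [apply: ReesD|rewrite coefD; apply: locD].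
- by split; [apply: ReesM|rewrite coef0M; apply: locZ => //; apply: Rees_coef0].
Qed.

(* A class [y T^k] not killed by the powers of [alpha T] yields, by avoiding the
   products of these powers with the elements outside the maximal homogeneous
   ideal, a prime strictly contained in the latter. *)
Lemma koszul_dim_pos k y alpha : loc P (I 1) alpha ->
  (forall x, loc P P x -> loc P (I k) (x * y)) ->
  (forall t : nat, ~ loc P (I (k + t)) (alpha ^+ t * y)) ->
  krull_dim_gt Rees (@ffun_lmul _ _) (koszul_cycle f Rees m.-1)
    (koszul_boundary f Rees m.-1) 0.
Proof.
move=> Ialpha coly Ny; pose aT : {poly {fraction S}} := alpha *: 'X.
have RaT (t : nat) : Rees (aT ^+ t).
  by apply: ReesX; rewrite /aT -['X]expr1; apply: ReesCXn.
pose Sigma q := Rees q /\ exists (t : nat) r, [/\ Rees r, ~ loc P P r`_0 & q = aT ^+ t * r].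
have aTE (t : nat) : aT ^+ t = alpha ^+ t *: 'X^t by rewrite exprZn.
have colw : Rees_colon (y *: 'X^k).
  by move=> x Px; rewrite scalerA; apply/ReesCXn/coly.
have [|||Q [primeQ annQ disjQ]] :=
    @exists_prime_avoiding _ Rees koszul_ann Sigma Rees1 ReesD ReesM ann_koszul_ideal.
- split; first exact: Rees1.
  exists 0%N, 1; rewrite mulr1 coef1 expr0; split=> //; [exact: Rees1|exact: locP1].
- move=> q q' [Rq [t [r [Rr Nr qE]]]] [Rq' [t' [r' [Rr' Nr' qE']]]].
  split; first exact: ReesM.
  exists (t + t')%N, (r * r'); rewrite qE qE' exprD mulrACA coef0M; split=> //; first exact: ReesM.
  by move=> /(locP_prime (Rees_coef0 Rr) (Rees_coef0 Rr'))[].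
(* If aT^t r kills the class of y T^k, the coefficient of degree k + t puts alpha^t y r_0 in the
   localized ideal, and r_0 is a unit: a contradiction. *)
- move=> q /ann_koszulP[_ /(_ _ colw) Rw] [_ [t [r [Rr Nr qE]]]].
  have [nzr Rrv] := loc_ringV (Rees_coef0 Rr) Nr.
  apply: (Ny t); have := Rw (k + t)%N; rewrite qE aTE.
  have -> : alpha ^+ t *: 'X^t * r * (y *: 'X^k) = (alpha ^+ t * y) *: ('X^(k + t) * r).
    rewrite -!scalerAl -scalerAr scalerA; congr (_ *: _).
    by rewrite addnC exprD; ring.
  rewrite coefZ coefXnM ltnn subnn => /(locZ (idealI _) Rrv).
  by rewrite mulrCA mulVf ?mulr1.
(* [Q] lies in [Rees_max] because everything outside the latter is in [Sigma] with exponent t = 0;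
   the inclusion is strict because [aT] lies in both [Sigma] and [Rees_max]. *)
exists 1%N, (fun i => if i is 0 then Q else Rees_max); split=> //.
- move=> [_|i _]; split=> //; first exact: Rees_max_prime.
  move=> q annq; split; first by have [] := annq.
  apply: boolp.contrapT => Nq; apply: (disjQ q (annQ q annq)).
  by have [Rq _] := annq; split=> //; exists 0%N, q; rewrite mul1r.
move=> [|//] _; split=> [q Qq|].
  have [[QR _ _ _] _ _] := primeQ; have Rq := QR q Qq; split=> //.
  apply: boolp.contrapT => Nq; apply: (disjQ q Qq).
  by split=> //; exists 0%N, q; rewrite mul1r.
move=> sub; have RaT1 := RaT 1%N; rewrite expr1 in RaT1; apply: (disjQ aT).
  by apply: sub; split=> //; rewrite coefZ coefX mulr0; apply: loc0.
split=> //; exists 1%N, 1; rewrite mulr1 expr1 coef1.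
by split=> //; [exact: Rees1|exact: locP1].
Qed.

(** The homology vanishes in degrees at least [k1], so its annihilator contains the maximal ideal of
    S_P and all elements of order at least [k1] in T. A prime above it contains [Rees_max], which is
    maximal, so no two such primes form a strict chain. *)
Lemma koszul_dim0 k1 :
  (forall k y, (k1 <= k)%N -> (forall x, loc P P x -> loc P (I k) (x * y)) ->
    loc P (I k) y) ->
  ~ krull_dim_gt Rees (@ffun_lmul _ _) (koszul_cycle f Rees m.-1)
    (koszul_boundary f Rees m.-1) 0.
Proof.
move=> sat [d [Q [d_gt0 primeQ chainQ]]].
have colcoef w k : Rees_colon w -> (k1 <= k)%N -> loc P (I k) w`_k.
  by move=> colw lek; apply: sat => // x /colw/(_ k); rewrite coefZ.
have ann_high q : Rees q -> (forall k, (k < k1)%N -> q`_k = 0) -> koszul_ann q.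
  move=> Rq q0; apply/ann_koszulP; split=> // w colw.
  move=> k; rewrite coefM.
  have [lek|ltk] := leqP k1 k; last first.
    rewrite big1 => [|i _]; first exact: loc0.
    by rewrite q0 ?mul0r // (leq_ltn_trans _ ltk) // -ltnS.
  (* Multiplying by [x] may be moved onto [w], where the colon condition brings x w into the Rees
     algebra. *)
  apply: sat => // x Px; rewrite -coefM -coefZ scalerAr.
  by apply: ReesM => //; apply: colw.
have ann_P x : loc P P x -> koszul_ann x%:P.
  move=> Px; apply/ann_koszulP; split=> [|w colw]; first exact/ReesC/(loc_sub Px).
  by rewrite mul_polyC; apply: colw.
have max_sub i q : (i <= d)%N -> Rees_max q -> Q i q.
  move=> /primeQ[[[QR Q0 QD QM] NQ1 Qprime] annQ] [Rq Pq].
  have Rq' : Rees (q - (q`_0)%:P).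
    by apply: ReesD => //; apply/ReesN/ReesC/(loc_sub Pq).
  have Qpow (t : nat) r : Rees r -> Q i (r ^+ t) -> Q i r.
    move=> Rr; elim: t => [|t IH]; first by move/NQ1.
    by rewrite exprS => /(Qprime _ _ Rr (ReesX t Rr))[].
  rewrite -[q](subrK (q`_0)%:P); apply: QD; last exact/annQ/ann_P.
  (* Without its constant term [q] is divisible by T, so its [k1]-th power has order at least
     [k1]. *)
  apply: (Qpow k1) => //; apply/annQ/ann_high.
    exact: ReesX.
  have q'X : (q - (q`_0)%:P) = 'X * \poly_(j < size q) q`_j.+1.
    apply/polyP => j; rewrite coefB coefC coefXM coef_poly; case: j => [|j] /=.
      by rewrite subrr.
    rewrite subr0; case: ltnP => // leq_; rewrite nth_default //.
    exact: leq_trans leq_ (leqnSn _).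
  by move=> k ltk; rewrite q'X exprMn coefXnM ltk.
have [[[Q1R _ Q1D Q1M] NQ1 _] _] := primeQ 1%N d_gt0.
have [sub01 N10] := chainQ 0%N d_gt0; apply: N10 => q Q1q.
have Rq := Q1R q Q1q; apply: (max_sub 0%N) => //; split=> //.
apply: boolp.contrapT => Nq; apply: NQ1.
have [nzq Rqv] := loc_ringV (Rees_coef0 Rq) Nq.
(* With a unit constant coefficient, 1 minus the normalized [q] has constant coefficient 0, hence
   lies in [Rees_max] and in the prime [Q 1]; then so does 1. *)
rewrite -[1](subrK ((q`_0)^-1 *: q)); apply: Q1D; last first.
  by rewrite -mul_polyC; apply: Q1M => //; apply: ReesC.
apply: (max_sub 1%N) => //; split.
  by apply: ReesD; [exact: Rees1|apply/ReesN/ReesZ].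
by rewrite coefB coef1 coefZ mulVf // subrr; apply: loc0.
Qed.

End LocalRees.
(** * Powers of a monomial ideal at a prime generated by variables *)

Section CommonDenominator.
Variables (S : idomainType) (P : S -> Prop).
Hypothesis primeP : is_prime (@whole S) P.

Lemma prime_prod (T : finType) (s : T -> S) :
  (forall i, ~ P (s i)) -> ~ P (\prod_i s i).
Proof.
have [_ NP1 PM] := primeP; move=> Ns.
by elim/big_ind: _ => // x y Nx Ny /PM[].
Qed.

Lemma common_denominator (I : S -> Prop) (T : finType) (x : T -> {fraction S}) :
  is_ideal (@whole S) I -> (forall i, loc P I (x i)) ->
  exists2 s, ~ P s &
    exists2 b : T -> S, forall i, I (b i) & forall i, tofrac s * x i = tofrac (b i).
Proof.
move=> [_ _ _ IM] /boolp.choice[a /boolp.choice[s asP]].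
have Ns i : ~ P (s i) by have [] := asP i.
exists (\prod_i s i); first exact: prime_prod.
exists (fun i => (\prod_(j | j != i) s j) * a i) => i.
  by apply: IM => //; have [] := asP i.
have [_ _ ->] := asP i; rewrite (bigD1 i) //= !tofracM.
rewrite mulrC -!mulrA [(tofrac (s i))^-1 * _]mulrA mulVf ?mul1r 1?mulrC //.
rewrite tofrac_eq0; apply: contra_notN (Ns i) => /eqP->.
by have [[]] := primeP.
Qed.

End CommonDenominator.

(** * Colons of powers of I(A) by I(B), before and after localization *)

Section LocalMonomial.
Variables (n : nat) (K : fieldType) (A B : {fset 'X_{1..n}}).
Hypotheses (nzB : B != fset0) (Bvar : forall b, b \in B -> exists i : 'I_n, b = U_(i)%MM).
Implicit Types (c d : 'X_{1..n}) (f g u : {mpoly K[n]}) (x y : {fraction {mpoly K[n]}}).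

Local Notation S := {mpoly K[n]}.
Local Notation p := (monomial_ideal K B).
Local Notation powers := (ideal_pow (@whole S) (monomial_ideal K A)).

Let primep : is_prime (@whole S) p := var_ideal_prime K Bvar.

Lemma powers_ideal k : is_ideal (@whole S) (powers k).
Proof.
split=> // [|x y|a x _]; [exact: ideal_gen0|exact: ideal_genD|exact: ideal_genM].
Qed.

Lemma powers01 : powers 0%N 1.
Proof. by apply/powersP => m _; apply: Pset0. Qed.

Lemma powersM j k f g : powers j f -> powers k g -> powers (j + k)%N (f * g).
Proof. by rewrite !powersP; apply: supportedM => m1 m2; apply: PsetD. Qed.

Lemma supportedXM (Q : 'X_{1..n} -> Prop) d g :
  supported Q ('X_[d] * g) <-> forall c, c \in msupp g -> Q (c + d)%MM.
Proof.
have E : msupp ('X_[d] * g) =i [seq (d + c)%MM | c <- msupp g].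
  by rewrite mulrC; apply/perm_mem/msuppMX.
split=> [Qg c cg|Qg m]; first by apply: Qg; rewrite E addmC map_f.
by rewrite E => /mapP[c cg ->]; rewrite addmC; apply: Qg.
Qed.

Lemma not_Pset1D c d : ~ Pset B 1 c -> ~ Pset B 1 d -> ~ Pset B 1 (c + d)%MM.
Proof.
move=> Nc Nd /(Pset1_var Bvar)[i iB]; rewrite mnmDE => cd.
have [ci|ci] := eqVneq (c i) 0%N; last by apply: Nc; apply/(Pset1_var Bvar); exists i.
by apply: Nd; apply/(Pset1_var Bvar); exists i => //; move: cd; rewrite ci.
Qed.

Lemma not_Pset1_0 : ~ Pset B 1 0%MM.
Proof. by move=> /(Pset1_var Bvar)[i _]; rewrite mnm0E. Qed.

Lemma not_var_idealX d : ~ Pset B 1 d -> ~ p 'X_[d].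
Proof. by move=> Nd /monomial_idealP/supportedX. Qed.

(** Each exponent [c] of [g] satisfies one implication of the solution property, so it must fail the
    other: some [d] outside P_1(B) has [c + d] in P_k(A). The sum of these [d] over the support
    serves for all terms at once and still involves no variable of I(B). *)
Lemma unsolvable_colon k g : ~ (exists c, is_solution A B k c) ->
  (forall d, Pset B 1 d -> powers k ('X_[d] * g)) ->
  exists2 D, ~ Pset B 1 D & powers k ('X_[D] * g).
Proof.
move=> Nsol colg.
have /boolp.choice[D DP] c : exists d, ~ Pset B 1 d /\ (c \in msupp g -> Pset A k (c + d)%MM).
  have [cg|Ncg] := boolP (c \in msupp g); last by exists 0%MM; split=> //; apply: not_Pset1_0.
  apply: boolp.contrapT => ND; apply: Nsol; exists c => d; split=> [cdP|Bd].
    by apply: boolp.contrapT => Nd; apply: ND; exists d.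
  by have /powersP/supportedXM := colg d Bd; apply.
exists (\big[+%MM/0%MM]_(c <- msupp g) D c).
  elim/big_ind: _ => [|u v|c _]; [exact: not_Pset1_0|exact: not_Pset1D|by have [] := DP c].
apply/powersP/supportedXM => c cg; rewrite (bigD1_seq c) //= addmA.
by apply: Pset_addr; have [_] := DP c; apply.
Qed.

(** If no solution existed, a monomial outside I(B) would multiply [g] into the power, although the
    colon is I(B). Conversely a solution [c] gives the witness x^c. *)
Lemma ass_solvable k : Ass (powers k) p <-> exists c, is_solution A B k c.
Proof.
split=> [[_ [g gP]]|[c solc]].
  apply: boolp.contrapT => /unsolvable_colon-/(_ g)[d Bd|D ND /gP]; last exact: not_var_idealX.
  by apply/gP/monomial_idealP/supportedX.
split=> //; exists 'X_[c] => x; rewrite monomial_idealP powersP mulrC supportedXM.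
by split=> [sx d /sx/solc|sx d /sx]; rewrite addmC // => /solc.
Qed.

(** Supplies [koszul_dim_pos] with the class of x^c T^k and the element x^a T, no power of which
    kills it. *)
Lemma colon_solution k c t a : is_solution A B k c -> is_solution A B (k + t) (a *+ t + c)%MM ->
  (forall x, loc p p x -> loc p (powers k) (x * tofrac 'X_[c])) /\
  ~ loc p (powers (k + t)) (tofrac 'X_[a] ^+ t * tofrac 'X_[c]).
Proof.
move=> sol solt; split=> [x px|].
  apply: (@locM _ _ primep p (eq 'X_[c])) px _; last exact: loc_tofrac.
  move=> f _ /monomial_idealP pf <-; rewrite mulrC; apply/powersP/supportedXM => d /pf.
  by rewrite addmC => /sol.
rewrite -tofracXn -tofracM mpolyXn -mpolyXD -[tofrac _]divr1 -tofrac1.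
have Np1 : ~ p 1 by have [] := primep.
move=> /(loc_fracP primep _ (powers_ideal _) Np1)[s Ns]; rewrite mulrC => /powersP/supportedXM ss.
by apply: Ns; apply/monomial_idealP => d /ss; rewrite addmC => /solt.
Qed.

Lemma var_idealX_dvd i f : monomial_ideal K [fset U_(i)%MM]%fset f ->
  exists u, f = 'X_i * u.
Proof.
elim/ideal_gen_ind: f / => [|_ _ [u ->] [v ->]|a _ _ [m /fset1P-> ->]].
- by exists 0; rewrite mulr0.
- by exists (u + v); rewrite mulrDr.
by exists a; rewrite mulrC.
Qed.

(** The fraction [y] is first shown to lie in S_p, by proving that the numerator of x_i y is
    divisible by x_i. After clearing denominators, [unsolvable_colon] provides a multiplier outside
    I(B). *)
Lemma unsolvable_saturated k y : (0 < k)%N -> ~ (exists c, is_solution A B k c) ->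
    (#|` B| = 1%N -> subset_of (monomial_ideal K A) p) ->
    (forall x, loc p p x -> loc p (powers k) (x * y)) ->
  loc p (powers k) y.
Proof.
move=> k_gt0 Nsol cardB coly.
have /fset0Pn[b bB] := nzB; have [i Eb] := Bvar bB; rewrite {b}Eb in bB.
pose p1 := monomial_ideal K [fset U_(i)%MM]%fset.
have p1var b : b \in [fset U_(i)%MM]%fset -> exists i : 'I_n, b = U_(i)%MM.
  by move=> /fset1P->; exists i.
have primep1 : is_prime (@whole S) p1 := var_ideal_prime K p1var.
have p1p f : p1 f -> p f.
  rewrite /p1 !monomial_idealP => sf m /sf/Pset1[_ /fset1P-> im].
  by apply/Pset1; exists U_(i)%MM.
have pX j : U_(j)%MM \in B -> p 'X_j.
  by move=> jB; apply/monomial_idealP/supportedX/Pset1; exists U_(j)%MM; rewrite ?lepm_refl.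
have nzf s : ~ p s -> tofrac s != 0.
  by move=> Ns; rewrite tofrac_eq0; apply: contra_notN Ns => /eqP->; have [[]] := primep.
have nzX j : tofrac ('X_j : S) != 0 by rewrite tofrac_eq0 -msupp_eq0 msuppX.
have [b [s [bI Ns yE]]] := coly _ (loc_tofrac primep (pX i bB)).
have p1b : p1 b.
  (* With a second variable x_j, comparing x_j (x_i y) and x_i (x_j y) puts x_j s' b in the prime
     (x_i), which contains neither x_j nor s'. *)
  have [[j jB nji]|only] := boolp.EM (exists2 j, U_(j)%MM \in B & j != i).
    have [b' [s' [_ Ns' yE']]] := coly _ (loc_tofrac primep (pX j jB)).
    have /eqP : tofrac ('X_j * b) / tofrac s = tofrac ('X_i * b') / tofrac s'.
      by rewrite !tofracM -!mulrA -yE -yE' mulrCA.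
    rewrite eqr_div ?nzf // -!tofracM tofrac_eq => /eqP E.
    have [[_ _ _ p1M] _ p1prime] := primep1.
    have : p1 (('X_j * s') * b).
      rewrite mulrAC E -mulrA mulrC; apply: p1M => //.
      by apply/monomial_idealP/supportedX/Pset1; exists U_(i)%MM; rewrite ?inE ?lepm_refl.
    move=> /(p1prime ('X_j * s') b I I)[|//] /(p1prime 'X_j s' I I)[|/p1p//].
    move=> /monomial_idealP/supportedX/Pset1[_ /fset1P->].
    by rewrite lep1mP mnm1E (negPf nji).
  (* Otherwise I(B) = (x_i), and [b] lies in I(A)^k, hence in I(A) as k > 0, hence in (x_i) by the
     hypothesis on singletons. *)
  have BE : B = [fset U_(i)%MM]%fset.
    apply/fsetP => b'; rewrite !inE; apply/idP/eqP => [b'B|->//].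
    have [j Ej] := Bvar b'B; rewrite Ej in b'B *; have [->//|nji] := eqVneq j i.
    by case: only; exists j.
  rewrite /p1 -BE; apply: cardB; first by rewrite BE cardfs1.
  by move/powersP: bI => bI; apply/monomial_idealP => m /bI; apply: Pset_le.
have [u bE] := var_idealX_dvd p1b.
have yus : y = tofrac u / tofrac s.
  by apply: (mulfI (nzX i)); rewrite yE bE tofracM mulrA.
(* One multiplier per variable clears the denominator of x_j y; their product works for all
   variables and stays outside the prime. *)
have /boolp.choice[t tP] (j : 'I_n) :
    exists t, ~ p t /\ (U_(j)%MM \in B -> powers k (t * ('X_j * u))).
  have [jB|_] := boolP (U_(j)%MM \in B); last by exists 1; split=> //; have [] := primep.
  have := coly _ (loc_tofrac primep (pX j jB)).
  rewrite yus mulrA -tofracM => /(loc_fracP primep _ (powers_ideal k) Ns)[t Nt tI].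
  by exists t.
have NT : ~ p (\prod_j t j) by apply: prime_prod => // j; have [] := tP j.
have [d /(Pset1_var Bvar)[j jB dj]|D ND DI] := unsolvable_colon (g := (\prod_j t j) * u) Nsol.
  rewrite -(submK (_ : (U_(j) <= d)%MM)) ?lep1mP // mpolyXD (bigD1 j) //=.
  set T := \prod_(_ | _) _; have [_ _ _ IM] := powers_ideal k.
  have -> : 'X_[d - U_(j)] * 'X_j * (t j * T * u) = ('X_[d - U_(j)] * T) * (t j * ('X_j * u)).
    by ring.
  by apply: IM => //; have [_] := tP j; apply.
rewrite yus; apply/(loc_fracP primep _ (powers_ideal k) Ns).
exists ('X_[D] * \prod_j t j); last by rewrite -mulrA.
by have [_ _ pM] := primep => /pM[] //; apply: not_var_idealX.
Qed.

Definition var_gen (i : 'I_#|` B|) : {fraction S} := tofrac 'X_[nth 0%MM B i].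

Lemma mem_nthB (i : 'I_#|` B|) : nth 0%MM B i \in B.
Proof. exact: mem_nth. Qed.

Lemma var_ideal_comb u : p u ->
  exists c : 'I_#|` B| -> S, u = \sum_i c i * 'X_[nth 0%MM B i].
Proof.
elim/ideal_gen_ind: u / => [|_ _ [c ->] [c' ->]|a _ _ [b bB ->]].
- by exists (fun=> 0); rewrite big1 // => i _; rewrite mul0r.
- by exists (fun i => c i + c' i); rewrite -big_split; apply: eq_bigr => i _; rewrite mulrDl.
have ltb : (index b B < #|` B|)%N by rewrite index_mem.
exists (fun i => if i == Ordinal ltb then a else 0).
rewrite (bigD1 (Ordinal ltb)) //= eqxx nth_index // big1 ?addr0 // => i /negPf->.
by rewrite mul0r.
Qed.

Lemma loc_var_comb x : loc p p x ->
  exists2 a, forall i, loc_ring p (a i) & x = \sum_i a i * var_gen i.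
Proof.
move=> [u [s [/var_ideal_comb[c ->] Ns ->]]].
exists (fun i => tofrac (c i) / tofrac s) => [i|]; first by exists (c i), s.
rewrite rmorph_sum /= mulr_suml; apply: eq_bigr => i _.
by rewrite tofracM mulrAC.
Qed.

Lemma loc_var_gen i : loc p p (var_gen i).
Proof.
apply/(loc_tofrac primep)/monomial_idealP/supportedX/Pset1.
by exists (nth 0%MM B i); rewrite ?mem_nthB ?lepm_refl.
Qed.

(* Contains [p ^ 2] and detects the linear parts, up to [p], of its elements. *)
Let double u := p u /\ forall i : 'I_n, U_(i)%MM \in B -> p u^`M(i).

Let double_ideal : is_ideal (@whole S) double.
Proof.
have [pA p0 pD pM] := monomial_ideal_is_ideal K B.
split=> // [|u v [pu du] [pv dv]|a u _ [pu du]].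
- by split=> // i _; rewrite mderiv0.
- by split=> [|i iB]; rewrite ?mderivD; apply: pD => //; [exact: du|exact: dv].
split=> [|i iB]; first exact: pM.
by rewrite mderivM; apply: pD; apply: pM => //; apply: du.
Qed.

Let double_mul u v : p u -> p v -> double (u * v).
Proof.
have [pA p0 pD pM] := monomial_ideal_is_ideal K B.
move=> pu pv; split=> [|i iB]; first exact: pM.
by rewrite mderivM; apply: pD; [|rewrite mulrC]; apply: pM.
Qed.

(** The variables are independent modulo the square of the maximal ideal: clear denominators in a
    relation, differentiate by the variable x_j at position [i], and reduce modulo I(B). Only the
    [i]-th coefficient, times a multiplier outside I(B), survives. *)
Lemma is_mu_var : is_mu (loc_ring p) (loc p p) (loc p p) #|` B|.
Proof.
exists var_gen; split=> [i|x /loc_var_comb[a Ra ->]|a Ra].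
- exact: loc_var_gen.
- by exists a => //; rewrite subrr; apply: ideal_gen0.
have sub x : ideal_mul (loc_ring p) (loc p p) (loc p p) x -> loc p double x.
  elim/ideal_gen_ind: x / => [|x y|c _ Rc [y [z [py pz ->]]]].
  - exact: loc0.
  - exact: locD.
  by apply: locZ => //; apply: (locM primep double_mul).
move=> /sub; have [s Ns [b _ bE]] := common_denominator primep (whole_ideal _) Ra.
have nzs : tofrac s != 0.
  by rewrite tofrac_eq0; apply: contra_notN Ns => /eqP->; have [[]] := primep.
have -> : \sum_i a i * var_gen i = tofrac (\sum_i b i * 'X_[nth 0%MM B i]) / tofrac s.
  rewrite rmorph_sum /= mulr_suml; apply: eq_bigr => i _.
  by rewrite tofracM -bE -(mulrA (tofrac s)) [RHS]mulrC mulKf.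
move=> /(loc_fracP primep _ double_ideal Ns)[t Nt [_ dt]] i.
have ai : a i = tofrac (b i) / tofrac s by rewrite -bE mulrC mulKf.
rewrite ai; exists (b i), s; split=> //.
have [j Ej] := Bvar (mem_nthB i).
have kM f g : kill_vars B (f * g) = kill_vars B f * kill_vars B g :> S by exact: rmorphM.
have kD f g : kill_vars B (f + g) = kill_vars B f + kill_vars B g :> S by exact: rmorphD.
have kS F : kill_vars B (\sum_(l < #|` B|) F l) = \sum_l kill_vars B (F l) :> S.
  exact: raddf_sum.
have kX (l : 'I_#|` B|) : kill_vars B 'X_[nth 0%MM B l] = 0 :> S.
  apply: (kill_varsX K Bvar _).1; apply/Pset1.
  by exists (nth 0%MM B l); rewrite ?mem_nthB ?lepm_refl.
have kdX (l : 'I_#|` B|) : kill_vars B 'X_[nth 0%MM B l]^`M(j) = (l == i)%:R :> S.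
  have -> : 'X_[nth 0%MM B l]^`M(j) = (l == i)%:R :> S.
    have [q Eq] := Bvar (mem_nthB l); rewrite Eq mderivX mnm1E.
    have -> : (q == j) = (l == i).
      rewrite -[RHS]val_eqE /= -(nth_uniq 0%MM (ltn_ord l) (ltn_ord i) (fset_uniq B)).
      by rewrite Ej Eq; apply/eqP/eqP => [->//|/mnmP/(_ j)]; rewrite !mnm1E eqxx; case: eqP.
    case: eqVneq => [li|_]; last by rewrite scale0r.
    have -> : U_(q)%MM = U_(j)%MM by rewrite -Eq -Ej li.
    have -> : (U_(j) - U_(j) = 0 :> 'X_{1..n})%MM by apply/mnmP => r; rewrite !mnmE subnn.
    by rewrite scale1r mpolyX0.
  by case: (l == i); [exact: rmorph1|exact: raddf0].
have jB : U_(j)%MM \in B by rewrite -Ej mem_nthB.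
move: (dt j jB) Nt; rewrite !monomial_idealP -!(kill_varsP Bvar).
rewrite mderivM kD !kM kS big1 => [|l _]; last by rewrite kM kX mulr0.
rewrite mulr0 add0r raddf_sum kS (bigD1 i) //= big1 => [|l nli]; last first.
  by rewrite mderivM kD !kM kX kdX (negPf nli) !mulr0 addr0.
rewrite mderivM kD !kM kX kdX eqxx mulr0 add0r mulr1 addr0 => /eqP.
by rewrite mulf_eq0 => /orP[/eqP ->|/eqP].
Qed.

(** Without the variable at position [i] the others generate the localization of a smaller prime of
    variables, which contains neither this variable nor any denominator. *)
Lemma is_min_gens_var : is_min_gens (loc_ring p) (loc p p) var_gen.
Proof.
split=> [x|i].
  split=> [/loc_var_comb[a Ra ->]|].
    by apply: ideal_gen_sum => i _; apply: ideal_gen_mem => //; exists i.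
  elim/ideal_gen_ind: x / => [|x y|a _ Ra [i ->]].
  - by apply: loc0 => //; have [] := primep.
  - by apply: locD => //; have [] := primep.
  by apply: locZ => //; [have [] := primep|apply: loc_var_gen].
pose B' := [fset b in B | b != nth 0%MM B i]%fset.
have B'B b : b \in B' -> b \in B by rewrite !inE => /andP[].
have B'var b : b \in B' -> exists i : 'I_n, b = U_(i)%MM by move=> /B'B/Bvar.
have idB' := monomial_ideal_is_ideal K B'.
have [_ _ primeB'] := var_ideal_prime K B'var.
move=> /(_ (var_gen i))[/(_ (loc_var_gen i)) gen _].
have : loc p (monomial_ideal K B') (var_gen i).
  elim/ideal_gen_ind: (var_gen i) / gen => [|x y|a _ Ra [j nji ->]].
  - exact: loc0.
  - exact: locD.
  apply: locZ => //; apply/(loc_tofrac primep)/monomial_idealP/supportedX/Pset1.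
  exists (nth 0%MM B j); rewrite ?lepm_refl // !inE mem_nthB /=.
  by rewrite nth_uniq ?fset_uniq.
have Np1 : ~ p 1 by have [] := primep.
rewrite -[var_gen i]divr1 -tofrac1 => /(loc_fracP primep _ idB' Np1)[t Nt].
move=> /(primeB' _ _ I I)[/monomial_idealP tB'|].
  by apply/Nt/monomial_idealP => m /tB'/Pset1[b /B'B bB lebm]; apply/Pset1; exists b.
move=> /monomial_idealP/supportedX/(Pset1_var B'var)[j].
have [l El] := Bvar (mem_nthB i); rewrite El !inE mnm1E El => /andP[_ /negP nlj].
by case: (eqVneq l j) => // lj _; case: nlj; rewrite lj.
Qed.

End LocalMonomial.

(** * The equivalences and the linear growth of the optimal modulus *)

Theorem theorem3p1 (n : nat) (K : fieldType) (A B : {fset 'X_{1..n}}) :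
  (1 <= n)%N -> A != fset0 -> B != fset0 ->
  0%MM \notin A ->
  (forall b, b \in B -> exists i : 'I_n, b = U_(i)%MM) ->
  let I_A := monomial_ideal K A in
  let p := monomial_ideal K B in
  let powers := ideal_pow (@whole {mpoly K[n]}) I_A in
  let cond_a := eventually (fun k => exists c, is_solution A B k c) in
  let cond_b := eventually (fun k => Ass (powers k) p) in
  let cond_c :=
    koszul_dim_gt p powers 0 /\ (#|` B| = 1%N -> subset_of I_A p) in
  (cond_a <-> cond_b) /\
  (cond_b <-> cond_c) /\
  (cond_a \/ cond_b \/ cond_c ->
   exists a b : int,
     (exists2 v, v \in A & a = (mdeg v)%:Z) /\
     eventually (fun k =>
       (exists c, is_optimal_solution A B k c) /\
       forall c, is_optimal_solution A B k c ->
         (mdeg c)%:Z = a * k%:Z + b)).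
Proof.
move=> _ _ nzB _ Bvar I_A p powers cond_a cond_b cond_c.
have primep := var_ideal_prime K Bvar.
have ab : cond_a <-> cond_b.
  by split=> -[k1 H]; exists k1 => k /H /(ass_solvable K A Bvar k).
have ac : cond_a -> cond_c.
  move=> sola; split=> [|_ f]; last first.
    (* For an exponent m of an element of I(A) and k = k1 + 1, the vector c + k m lies in P_k(A), so
       k m lies in P_1(B), and then so does m. *)
    have [k1 Hk] := sola; have [c sol] := Hk k1.+1 (leqnSn _).
    rewrite /I_A /p !monomial_idealP => Af m /Af/(Pset_mulm k1.+1) Am.
    have /sol/(Pset1_var Bvar)[i iB mi] : Pset A k1.+1 (c + m *+ k1.+1)%MM.
      by rewrite addmC; apply: Pset_addr.
    by apply/(Pset1_var Bvar); exists i => //; apply: contraNneq mi; rewrite mulmnE => ->.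
  have [k1 Hk] := sola.
  have /fset0Pn[b bB] := nzB; have [k0 step] := solution_step A bB.
  (* The step is large enough both for a solution to exist and for [solution_step] to apply to
     it. *)
  have [c sol] := Hk (maxn k0 k1).+1 (leqW (leq_maxr _ _)).
  have [a aA [_ solt]] := step _ c (leq_maxl _ _) sol.
  have ltb : (index b B < #|` B|)%N by rewrite index_mem.
  exists #|` B|, (@var_gen n K B); split.
  - exact: is_mu_var.
  - exact: is_min_gens_var.
  have col t := colon_solution K Bvar sol (solt t).
  apply: (@koszul_dim_pos _ _ primep powers (powers_ideal K A) (powers01 K A)
    (@powersM _ K A) _ _ _ _ (Ordinal ltb) _ _ (tofrac 'X_[c]) (tofrac 'X_[a])).
  - exact: loc_var_gen.
  - move=> x px; have [gen _] := is_min_gens_var K Bvar.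
    by apply/gen.
  - by rewrite tofrac_eq0 -msupp_eq0 msuppX.
  - apply: (loc_tofrac primep); apply/powersP/supportedX/Pset1.
    by exists a; rewrite ?lepm_refl.
  - exact: (col 0%N).1.
  by move=> t; apply: (col t).2.
have ca : cond_c -> cond_a.
  move=> [[m [f [_ [gen _] dim_gt0]]] cardB].
  have [//|[k1 Nsol]] := solvable_or_not A nzB.
  have fP j : loc p p (f j).
    apply/gen; rewrite -[f j]mul1r; apply: ideal_gen_mem; last by exists j.
    exact: loc_ring1.
  (* Some generator is nonzero, as they generate an ideal containing a variable. *)
  have [[j0 nzf]|f0] := boolp.EM (exists j0, f j0 != 0); last first.
    have /fset0Pn[b bB] := nzB; have /gen : loc p p (tofrac 'X_[b]).
      apply: (loc_tofrac primep); apply/monomial_idealP/supportedX/Pset1.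
      by exists b; rewrite ?lepm_refl.
    suff sub0 x : ideal_gen (loc_ring p) (fun y => exists j, y = f j) x -> x = 0.
      by move/sub0/eqP; rewrite tofrac_eq0 -msupp_eq0 msuppX.
    elim/ideal_gen_ind: x / => [//|x y -> ->|a _ _ [j ->]]; first exact: addr0.
    have [->|nzf] := eqVneq (f j) 0; first exact: mulr0.
    by case: f0; exists j.
  (* The threshold is at least 1 because saturation is available only for positive [k]. *)
  case: (@koszul_dim0 _ _ primep _ (powers_ideal K A) (powers01 K A) (@powersM _ K A)
    _ f fP (fun x => (gen x).1) j0 nzf (maxn k1 1) _ dim_gt0) => k y.
  rewrite geq_max => /andP[/Nsol Nsolk k_gt0].
  exact: unsolvable_saturated.
split=> //; split; first by tauto.
move=> H; apply: (optimal_modulus_linear nzB); tauto.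
Qed.
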